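(* Let $H_1$ and $H_2$ be selfadjoint operators in a separable Hilbert space $\mathfrak H$ which are bounded from below. Let $\mathsf i(H_j)=\{\mathsf i_j^+,\mathsf i_j^-,\mathsf i_j^0,\mathsf i_j^\infty\}$ be the inertia of $H_j$, $j=1,2$. Assume that $\mathsf i_1^-+\mathsf i_1^0<\infty$ and that $H_1\le H_2$. Let $H_j^+$ denote the Moore-Penrose inverse of $H_j$, $j=1,2$. Then $$H_2^+\le H_1^+\quad\text{if and only if}\quad \ker H_1=\ker H_2\ \text{ and }\ \mathsf i(H_1)=\mathsf i(H_2).$$
   Context: Operators are (in general unbounded) selfadjoint operators, identified with their graphs; a linear relation in $\mathfrak H$ is a linear subspace $H$ of $\mathfrak H\times\mathfrak H$, with $\operatorname{mul}H=\{k:\{0,k\}\in H\}$ and inverse $H^{-1}=\{\{k,h\}:\{h,k\}\in H\}$. Moore-Penrose inverse: for a selfadjoint operator $H$, $H^+:=PH^{-1}P$, where $H^{-1}$ is the inverse in the sense of relations and $P$ is the orthogonal projection onto $\overline{\operatorname{ran}}H$. Equivalently, with respect to $\mathfrak H=\overline{\operatorname{ran}}H\oplus\ker H$, $H^+$ is the selfadjoint operator which is the inverse of the injective operator $H|_{\overline{\operatorname{ran}}H\cap\operatorname{dom}H}$ on $\overline{\operatorname{ran}}H$ and is $0$ on $\ker H$. A selfadjoint operator $H$ is bounded from below by $m\in\mathbb R$ if $(Hh,h)\ge m(h,h)$ for all $h\in\operatorname{dom}H$; the supremum of all such $m$ is its lower bound. Ordering: for selfadjoint operators $H_1,H_2$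 with lower bounds $m_1,m_2$, $H_1\le H_2$ means that for some fixed $x<\min\{m_1,m_2\}$ (equivalently, for all such $x$) $0\le((H_2-x)^{-1}h,h)\le((H_1-x)^{-1}h,h)$ for all $h\in\mathfrak H$. (Under the stated assumptions $\mathsf i_1^-$ and $\mathsf i_2^-$ are finite and $H_1^+$, $H_2^+$ are bounded from below.) Inertia: with $E$ the spectral measure of $H$, $\mathsf i(H)=\{\mathsf i^+(H),\mathsf i^-(H),\mathsf i^0(H),\mathsf i^\infty(H)\}$ is the ordered quadruplet with $\mathsf i^+(H)=\dim\operatorname{ran}E((0,\infty))$, $\mathsf i^-(H)=\dim\operatorname{ran}E((-\infty,0))$, $\mathsf i^0(H)=\dim\ker H$, $\mathsf i^\infty(H)=\dim\operatorname{mul}H$ ($=0$ for operators), each in $\{0,1,2,\dots\}\cup\{\infty\}$. *)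

(* Defs.v *)
From HB Require Import structures.
From mathcomp Require Import all_boot all_order all_algebra.
From mathcomp Require Import all_classical all_reals all_analysis.
From mathcomp Require Import complex.

Set Implicit Arguments.
Unset Strict Implicit.
Unset Printing Implicit Defensive.

Import Order.TTheory GRing.Theory Num.Theory.
Import numFieldNormedType.Exports.

#[global] Open Scope classical_set_scope.
#[global] Open Scope ring_scope.
#[global] Open Scope complex_scope.

(* A complex Hilbert space is a complete normed space [V] over [R[i]] together
   with a positive definite hermitian form [ip : {dot V for conjC}] inducing the
   norm; [ip] is linear in its first argument. *)
Definition induces_norm (R : realType) (V : normedModType R[i])
    (ip : {dot V for Num.conj}) : Prop :=
  forall v : V, ip v v = `|v| ^+ 2.

Definition separable (T : topologicalType) : Prop :=
  exists2 D : set T, countable D & dense D.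

Section LinearRelations.
Context {R : realType} {V : normedModType R[i]}.
Variable ip : {dot V for Num.conj}.
Implicit Types (H K : set (V * V)) (S : set V) (h k : V) (x : R).

Definition rel_ker H : set V := [set h | H (h, 0)].
Definition rel_mul H : set V := [set k | H (0, k)].
Definition rel_ran H : set V := [set k | exists h, H (h, k)].

Definition rel_inv H : set (V * V) := [set p | H (p.2, p.1)].

(* [rel_mulr K H] is the product K H : first H, then K. *)
Definition rel_mulr K H : set (V * V) :=
  [set p | exists2 k, H (p.1, k) & K (k, p.2)].

Definition rel_shift H x : set (V * V) :=
  [set p | H (p.1, p.2 + x%:C *: p.1)].

(* The value at [h] of a relation that is a function at [h] (0 if there is no
   value at all). *)
Definition rel_val H h : V := xget 0 [set k | H (h, k)].

Definition adjoint H : set (V * V) :=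
  [set p | forall f g, H (f, g) -> ip g p.1 = ip f p.2].

(* A relation equal to its adjoint is automatically a closed linear subspace, and
   rel_mul H is then the orthogonal complement of dom H, so that the second
   conjunct also makes the domain dense. *)
Definition selfadjoint_operator H : Prop :=
  H = adjoint H /\ rel_mul H = [set 0].

Definition lower_bounds H : set R :=
  [set m | forall h k, H (h, k) -> m%:C * ip h h <= ip k h].

Definition bounded_from_below H : Prop := lower_bounds H !=set0.

(* Extended-valued: -oo when H is not bounded from below, +oo on the zero
   space. *)
Definition lower_bound H : \bar R := ereal_sup [set m%:E | m in lower_bounds H].

(* (H - x)^-1 h *)
Definition resolvent H x h : V := rel_val (rel_inv (rel_shift H x)) h.

(* On R[i], [a <= b] means that [b - a] is real and nonnegative. *)
Definition op_le H1 H2 : Prop :=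
  exists2 x : R, (x%:E < Order.min (lower_bound H1) (lower_bound H2))%E &
    forall h, 0 <= ip (resolvent H2 x h) h <= ip (resolvent H1 x h) h.

(* The graph of the orthogonal projection onto the closure of the subspace S. *)
Definition proj_closure S : set (V * V) :=
  [set p | closure S p.2 /\ forall s, S s -> ip (p.1 - p.2) s = 0].

Definition mp_inverse H : set (V * V) :=
  let P := proj_closure (rel_ran H) in
  rel_mulr P (rel_mulr (rel_inv H) P).

Definition orthogonal_projection (P : V -> V) : Prop :=
  [/\ linear P, forall h, P (P h) = P h & forall h k, ip (P h) k = ip h (P k)].

(* Projection-valued measures on the Borel sets of R, countably additive in the
   strong operator topology; only the values on Borel sets are relevant. *)
Definition projection_valued_measure
    (E : set R -> V -> V) : Prop :=
  [/\ forall B, measurable B -> orthogonal_projection (E B),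
      forall h, E setT h = h
    & forall F : nat -> set R,
        (forall n, measurable (F n)) -> trivIset setT F ->
        forall h, (fun n => \sum_(i < n) E (F i) h) @ \oo
                    --> E (\bigcup_n F n) h].

(* The scalar measure B |-> (E(B) h, h). *)
Definition scalar_measure (E : set R -> V -> V) h
    (B : set R) : \bar R :=
  (complex.Re (ip (E B h) h))%:E.

(* H is the integral of t dE(t): the domain of H consists of the h with
   \int t^2 d(E h, h) finite, and (H h, h) = \int t d(E h, h) there, which
   determines H by polarization. *)
Definition spectral_measure (E : set R -> V -> V) H : Prop :=
  [/\ projection_valued_measure E,
      forall h, (exists k, H (h, k)) <->
        (\int[scalar_measure E h]_t (t ^+ 2)%:E < +oo)%E
    & forall h k, H (h, k) ->
        ip k h = (fine (\int[scalar_measure E h]_t t%:E))%:C].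

Definition lin_indep n (b : 'I_n -> V) : Prop :=
  forall c : 'I_n -> R[i], \sum_i c i *: b i = 0 -> forall i, c i = 0.

(* The dimension of a subspace in {0, 1, 2, ...} with +oo added: all infinite
   dimensions are identified. *)
Definition subspace_dim S : \bar R :=
  ereal_sup [set n%:R%:E | n in [set n : nat |
    exists2 b : 'I_n -> V, (forall i, S (b i)) & lin_indep b]].

End LinearRelations.

Record inertia_index (R : realType) := InertiaIndex {
  ipos : \bar R; ineg : \bar R; izero : \bar R; iinf : \bar R }.

(* The inertia of H, where E is the spectral measure of H. *)
Definition inertia (R : realType) (V : normedModType R[i])
    (E : set R -> V -> V) (H : set (V * V)) :
    inertia_index R :=
  {| ipos := subspace_dim (range (E `]0, +oo[%classic));
     ineg := subspace_dim (range (E `]-oo, 0[%classic));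
     izero := subspace_dim (rel_ker H);
     iinf := subspace_dim (rel_mul H) |}.

(* Main.v *)
(* For real x < y with x below the lower bounds, H_1 <= H_2 says that the bounded
   operators A_j = (H_j - y)(H_j - x)^-1 = 1 - (y - x)(H_j - x)^-1 satisfy
   A_1 <= A_2, so no closed forms of unbounded operators are needed. The spectral
   projections of H_j for (-oo, 0) and (0, +oo) also split the form of A_j (taken
   at y = 0) and the form of H_j^+ by sign.

   If H_2^+ <= H_1^+ as well, these projections give injections in both
   directions between the spectral subspaces, hence i_1^+ = i_2^+ and
   i_1^- = i_2^-. When i_1^- = i_2^- is finite, ran E_2((-oo, 0)) is a maximal
   negative subspace for A_1, so that A_1 >= 0 on its A_1-orthogonal complement;
   with A_1 <= A_2 this forces ker H_2 into ker H_1, and the same argument for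
   H_2^+ <= H_1^+ gives the other inclusion.

   Conversely, a finite i_j^- leaves a gap (-e, 0) in the spectrum of H_j. For y
   in both gaps, A_1 and A_2 are invertible, and the same maximality gives
   A_2^-1 <= A_1^-1, i.e. (H_2 - y)^-1 <= (H_1 - y)^-1. Off the common kernel the
   resolvent of H_j^+ at 1/y is - y - y^2 (H_j - y)^-1, so H_2^+ <= H_1^+. *)
Require Import Defs.
From HB Require Import structures.
From mathcomp Require Import all_boot all_order all_algebra.
From mathcomp Require Import all_classical all_reals all_analysis.
From mathcomp Require Import measurable_realfun complex ring lra.

Set Implicit Arguments.
Unset Strict Implicit.
Unset Printing Implicit Defensive.

Import Order.TTheory GRing.Theory Num.Theory.
Import numFieldNormedType.Exports.

Local Open Scope classical_set_scope.
Local Open Scope ring_scope.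
Local Open Scope complex_scope.

(** * Inner products and orthogonal decompositions *)

(** Tolerances for choosing approximating sequences: minimizing vectors and preimages of nearby
    values. *)
Lemma null_sequence (R : realType) : exists2 q : nat -> R, (forall n, 0 < q n) &
  forall e, 0 < e -> exists N, forall n, (N <= n)%N -> q n < e.
Proof.
exists (fun n => n.+1%:R^-1) => [n|e e0]; first by rewrite invr_gt0.
exists (Num.truncn e^-1) => n Nn.
rewrite -[ltRHS]invrK ltf_pV2 ?posrE ?invr_gt0 //.
by apply: (lt_le_trans (Num.Theory.truncnS_gt _)); rewrite ler_nat.
Qed.

Section InnerProduct.
Context (R : realType) (V : normedModType R[i]) (ip : {dot V for Num.conj}).

(** All estimates are made on real parts, where real arithmetic applies; [ip_ext] and [ip_eq0] lead
    back to complex identities. *)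
Definition rip (u v : V) : R := complex.Re (ip u v).
Definition nsq (v : V) : R := rip v v.

Lemma ipC (u v : V) : ip u v = (ip v u)^*%C.
Proof. by rewrite hermC expr0 mul1r. Qed.

Lemma ip_eq0C (u v : V) : ip u v = 0 -> ip v u = 0.
Proof. by rewrite (ipC v) => ->; rewrite conjc0. Qed.

Lemma ipDl u v w : ip (u + v) w = ip u w + ip v w.
Proof. by rewrite linearDl. Qed.

Lemma ipDr u v w : ip w (u + v) = ip w u + ip w v.
Proof. by rewrite linearDr. Qed.

Lemma ipNl u w : ip (- u) w = - ip u w.
Proof. by rewrite linearNl. Qed.

Lemma ipNr u w : ip w (- u) = - ip w u.
Proof. by rewrite linearNr. Qed.

Lemma ip0l w : ip 0 w = 0.
Proof. by rewrite linear0l. Qed.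

Lemma ip0r w : ip w 0 = 0.
Proof. by rewrite linear0r. Qed.

Lemma ipZl (c : R[i]) u v : ip (c *: u) v = c * ip u v.
Proof. by rewrite linearZl_LR. Qed.

Lemma ipZr (c : R[i]) u v : ip u (c *: v) = c^*%C * ip u v.
Proof. by rewrite linearZr_LR. Qed.

Lemma ReM (t : R) (z : R[i]) : complex.Re (t%:C * z) = t * complex.Re z.
Proof. by case: z => a b /=; rewrite mul0r subr0. Qed.

Lemma ReD (z w : R[i]) : complex.Re (z + w) = complex.Re z + complex.Re w.
Proof. by case: z; case: w. Qed.

Lemma ReN (z : R[i]) : complex.Re (- z) = - complex.Re z.
Proof. by case: z. Qed.

Lemma ripC u v : rip u v = rip v u.
Proof. by rewrite /rip ipC; case: (ip v u). Qed.

Lemma ripDl u v w : rip (u + v) w = rip u w + rip v w.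
Proof. by rewrite /rip ipDl ReD. Qed.

Lemma ripDr u v w : rip w (u + v) = rip w u + rip w v.
Proof. by rewrite !(ripC w) ripDl. Qed.

Lemma ripNl u w : rip (- u) w = - rip u w.
Proof. by rewrite /rip ipNl ReN. Qed.

Lemma ripNr u w : rip w (- u) = - rip w u.
Proof. by rewrite !(ripC w) ripNl. Qed.

Lemma ripZl (t : R) u w : rip (t%:C *: u) w = t * rip u w.
Proof. by rewrite /rip ipZl ReM. Qed.

Lemma ripZr (t : R) u w : rip w (t%:C *: u) = t * rip w u.
Proof. by rewrite !(ripC w) ripZl. Qed.

Lemma rip0l w : rip 0 w = 0. Proof. by rewrite /rip ip0l. Qed.
Lemma rip0r w : rip w 0 = 0. Proof. by rewrite ripC rip0l. Qed.

Definition ipE := (ipDl, ipDr, ipNl, ipNr, ipZl, ipZr, ip0l, ip0r).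

Definition ripE :=
  (ripDl, ripDr, ripNl, ripNr, ripZl, ripZr, rip0l, rip0r).

Lemma ip_nsq v : ip v v = (nsq v)%:C.
Proof. by rewrite /nsq /rip RRe_real // ger0_real // dnorm_ge0. Qed.

Lemma nsq_ge0 v : 0 <= nsq v.
Proof. by rewrite -lecR -ip_nsq dnorm_ge0. Qed.

Lemma nsq_gt0 v : v != 0 -> 0 < nsq v.
Proof. by rewrite -ltcR -ip_nsq dnorm_gt0. Qed.

Lemma nsq_le0 v : nsq v <= 0 -> v = 0.
Proof.
by move=> v0; apply/eqP; apply: contraTT v0 => /nsq_gt0; rewrite -ltNge.
Qed.

Lemma nsq0 : nsq 0 = 0. Proof. by rewrite /nsq rip0l. Qed.

Lemma nsqN v : nsq (- v) = nsq v.
Proof. by rewrite /nsq !ripE opprK. Qed.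

Lemma nsqD_le u v : nsq (u + v) <= 2 * nsq u + 2 * nsq v.
Proof.
have := nsq_ge0 (u - v); rewrite /nsq !ripE (ripC v u); lra.
Qed.

Lemma nsqZ (c : R[i]) v :
  nsq (c *: v) = (complex.Re c ^+ 2 + complex.Im c ^+ 2) * nsq v.
Proof.
rewrite /nsq /rip ipZl ipZr -!/(rip _ _) ip_nsq.
by case: c => a b /=; rewrite !(mulr0, subr0, addr0, mul0r) /nsq /rip; ring.
Qed.

(** Multiplying by 1 and by -i exposes the real and the imaginary part. *)
Lemma ip_ext (f g h k : V) :
  (forall c : R[i], rip (c *: g) h = rip (c *: f) k) -> ip g h = ip f k.
Proof.
move=> e; apply/eqP; rewrite eq_complex; apply/andP.
have := e 1; have := e (- 'i%C); rewrite /rip !scale1r !ipZl.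
case: (ip g h) => a b; case: (ip f k) => a' b' /= ei e1.
by split; apply/eqP => //; lra.
Qed.

Lemma ip_eq0 u v : (forall c : R[i], rip (c *: u) v = 0) -> ip u v = 0.
Proof.
move=> h; transitivity (ip 0 v); last exact: ip0l.
by apply: ip_ext => c; rewrite h scaler0 rip0l.
Qed.

Lemma quadratic_discr (a b c : R) : 0 <= c ->
  (forall t, 0 <= a + 2 * t * b + t ^+ 2 * c) -> b ^+ 2 <= a * c.
Proof.
rewrite le0r => /orP[/eqP-> h|c0 h].
  have [->|b0] := eqVneq b 0; first by rewrite expr0n mulr0.
  (* At this t the affine function a + 2 t b takes the value -1. *)
  have := h (- (a + 1) / (2 * b)).
  have -> : 2 * (- (a + 1) / (2 * b)) * b = - (a + 1) by field.
  by rewrite mulr0; lra.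
have := h (- b / c).
have -> : a + 2 * (- b / c) * b + (- b / c) ^+ 2 * c = (a * c - b ^+ 2) / c.
  by field; rewrite gt_eqF.
by rewrite pmulr_lge0 ?invr_gt0 // subr_ge0.
Qed.

Lemma cauchy_schwarz u v : rip u v ^+ 2 <= nsq u * nsq v.
Proof.
apply: quadratic_discr => [|t]; first exact: nsq_ge0.
by have := nsq_ge0 (u + t%:C *: v); rewrite /nsq !ripE (ripC v u); lra.
Qed.

Definition subspace (S : set V) : Prop :=
  S 0 /\ forall (c : R[i]) u v, S u -> S v -> S (c *: u + v).

Lemma subspaceD S u v : subspace S -> S u -> S v -> S (u + v).
Proof. by move=> [_ h] Su Sv; have := h 1 _ _ Su Sv; rewrite scale1r. Qed.

Lemma subspaceZ S (c : R[i]) u : subspace S -> S u -> S (c *: u).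
Proof. by move=> [S0 h] Su; have := h c _ _ Su S0; rewrite addr0. Qed.

Lemma subspaceB S u v : subspace S -> S u -> S v -> S (u - v).
Proof.
by move=> sS Su Sv; apply: subspaceD => //; rewrite -scaleN1r; exact: subspaceZ.
Qed.

Lemma ip_eq_lim (f g h k : V) :
    (forall e, 0 < e -> exists p q, [/\ nsq (h - p) < e, nsq (k - q) < e &
      ip g p = ip f q]) ->
  ip g h = ip f k.
Proof.
move=> lim; apply: ip_ext => c.
apply/eqP; rewrite -subr_eq0 -sqrf_eq0; apply/eqP/le_anti.
rewrite sqr_ge0 andbT; apply/ler_addgt0Pl => e e0; rewrite addr0.
(* The tolerance fits (r - r')^2 <= 2 r^2 + 2 r'^2 with both squares bounded by Cauchy-Schwarz; the
   summand 1 keeps the divisor positive. *)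
have [d d0 dE] : exists2 d, 0 < d &
    (2 * nsq (c *: g) + 2 * nsq (c *: f) + 1) * d = e.
  set M := 2 * nsq (c *: g) + 2 * nsq (c *: f) + 1.
  have M0 : 0 < M.
    by have := nsq_ge0 (c *: g); have := nsq_ge0 (c *: f); rewrite /M; lra.
  by exists (e / M); rewrite ?divr_gt0 // mulrCA divff ?mulr1 // gt_eqF.
have [p [q [hp kq eq_pq]]] := lim d d0.
have -> : rip (c *: g) h - rip (c *: f) k =
          rip (c *: g) (h - p) - rip (c *: f) (k - q).
  have : rip (c *: g) p = rip (c *: f) q by rewrite /rip !ipZl eq_pq.
  by rewrite !ripE; lra.
have c1 := cauchy_schwarz (c *: g) (h - p).
have c2 := cauchy_schwarz (c *: f) (k - q).
have b1 : nsq (c *: g) * nsq (h - p) <= nsq (c *: g) * d.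
  by rewrite ler_wpM2l ?nsq_ge0 // ltW.
have b2 : nsq (c *: f) * nsq (k - q) <= nsq (c *: f) * d.
  by rewrite ler_wpM2l ?nsq_ge0 // ltW.
move: c1 c2; set r := rip _ _; set r' := rip _ _ => c1 c2.
have := sqr_ge0 (r + r'); rewrite -dE; lra.
Qed.

End InnerProduct.

(** * Completeness, closures and orthogonal projections *)

Section Completeness.
Context (R : realType) (V : completeNormedModType R[i]) (ip : {dot V for Num.conj}).
Context (ip_norm : induces_norm ip).
Local Notation rip := (rip ip).
Local Notation nsq := (nsq ip).
Local Notation subspace := (@subspace R V).

(** Bridge between the topology, whose norm takes values in [R[i]], and the real quantity [nsq]. *)
Lemma normr_lt (v : V) (e : R) : 0 < e -> (`|v| < e%:C) = (nsq v < e ^+ 2).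
Proof.
move=> e0; rewrite -(@ltr_pXn2r _ 2) ?nnegrE ?ler0c ?(ltW e0) //.
by rewrite -ip_norm ip_nsq -rmorphXn ltcR.
Qed.

Lemma closure_nsq (S : set V) u :
  closure S u <-> forall e, 0 < e -> exists2 s, S s & nsq (u - s) < e.
Proof.
split=> [clS e e0|approx B].
  have e0' : 0 < Num.sqrt e by rewrite sqrtr_gt0.
  have [s [Ss]] := clS _ (nbhsx_ballx u (Num.sqrt e)%:C ltac:(by rewrite ltcR)).
  rewrite -ball_normE /= normr_lt // sqr_sqrtr ?ltW // => us.
  by exists s.
move=> /nbhs_ballP [e /= e0 eB].
have eE : e = (complex.Re e)%:C by rewrite RRe_real // gtr0_real.
have e0' : 0 < complex.Re e by rewrite -ltcR -eE.
have [s Ss us] := approx _ (exprn_gt0 2 e0').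
by exists s; split => //; apply: eB; rewrite -ball_normE /= eE normr_lt.
Qed.

Lemma nsq_complete (u : nat -> V) :
    (forall e, 0 < e -> exists N, forall n m, (N <= n)%N -> (N <= m)%N ->
      nsq (u n - u m) < e) ->
  exists l, forall e, 0 < e -> exists N, forall n, (N <= n)%N ->
    nsq (l - u n) < e.
Proof.
move=> cau.
have cu : cvg (u @ \oo).
  apply/cauchy_cvgP/cauchy_ballP => e e0.
  have eE : e = (complex.Re e)%:C by rewrite RRe_real // gtr0_real.
  have e0' : 0 < complex.Re e by rewrite -ltcR -eE.
  have [N hN] := cau _ (exprn_gt0 2 e0').
  pose T := u @` [set n | (N <= n)%N]; exists (T, T) => /=.
    by split; exists N => // n Nn; exists n.
  move=> [_ _] [/= [n Nn <-] [m Nm <-]].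
  by rewrite -ball_normE /= eE normr_lt // hN.
exists (lim (u @ \oo)) => e e0.
have e0' : 0 < Num.sqrt e by rewrite sqrtr_gt0.
have /cvgrPdist_lt /(_ (Num.sqrt e)%:C) := cu.
rewrite ltcR => /(_ e0') [N _ hN]; exists N => n /hN /=.
by rewrite normr_lt // sqr_sqrtr // ltW.
Qed.

Lemma closure_orth (S : set V) u v :
  closure S u -> (forall s, S s -> ip v s = 0) -> ip v u = 0.
Proof.
move=> /closure_nsq clS vS; transitivity (ip 0 0); last exact: ip0l.
apply: ip_eq_lim => e /[dup] e0 /clS [s Ss us]; exists s, 0.
by split => //; rewrite ?subrr ?nsq0 // vS // ip0l.
Qed.

(* A sequence minimizing the distance to S is Cauchy by the parallelogram law. *)
Lemma orthogonal_decomposition (S : set V) h : subspace S ->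
  exists2 u, closure S u & forall s, S s -> ip (h - u) s = 0.
Proof.
move=> sS; set D := (fun s => nsq (h - s)) @` S.
have D_inf : has_inf D.
  split; first by exists (nsq (h - 0)), 0; case: sS.
  by exists 0 => _ [s _ <-]; exact: nsq_ge0.
have d_le s : S s -> inf D <= nsq (h - s).
  by move=> Ss; apply: ge_inf; [case: D_inf|exists s].
have [q q0 archi] := null_sequence R.
have [u hu] : {u : nat -> V & forall n,
    S (u n) /\ nsq (h - u n) < inf D + q n}.
  apply: (@choice _ _ (fun n v => S v /\ nsq (h - v) < inf D + q n)) => n.
  have [_ [s Ss <-] lt_s] := inf_adherent (q0 n) D_inf.
  by exists s.
have cau n m : nsq (u n - u m) <= 2 * q n + 2 * q m.
  have [[Sn hn] [Sm hm]] := (hu n, hu m).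
  have /d_le : S ((2^-1 : R)%:C *: (u n + u m)).
    by apply: subspaceZ => //; exact: subspaceD.
  rewrite /nsq in hn hm *; rewrite !ripE.
  rewrite !(ripE, ripC ip _ h, ripC ip (u m) (u n)) in hn hm *; lra.
have [l hl] : exists l, forall e, 0 < e -> exists N, forall n, (N <= n)%N ->
    nsq (l - u n) < e.
  apply: nsq_complete => e e0.
  have [N hN] := archi (e / 4) ltac:(by rewrite divr_gt0).
  exists N => n m Nn Nm; have := cau n m; have := hN n Nn; have := hN m Nm; lra.
exists l.
  apply/closure_nsq => e /hl [N hN]; exists (u N); first by case: (hu N).
  exact: hN.
move=> s Ss; apply: ip_eq0C; apply: ip_eq0 => c.
have /(subspaceZ c sS) := Ss; move: (c *: s) => w Sw.
apply/eqP; rewrite -sqrf_eq0; apply/eqP/le_anti; rewrite sqr_ge0 andbT.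
apply/ler_addgt0Pl => e e0; rewrite addr0.
have [d d0 dE] : exists2 d, 0 < d & (4 * nsq w + 1) * d = e.
  have M0 : 0 < 4 * nsq w + 1 by have := nsq_ge0 ip w; lra.
  by exists (e / (4 * nsq w + 1)); rewrite ?divr_gt0 // mulrCA divff ?mulr1 // gt_eqF.
have [[N1 hN1] [N2 hN2]] := (archi d d0, hl d d0).
set n := maxn N1 N2.
have n1 := hN1 n (leq_maxl _ _); have n2 := hN2 n (leq_maxr _ _).
have [Sn hn] := hu n.
(* [u n] is minimizing up to [q n], so moving it along [w] gives 0 <= q n + 2 t (w, h - u n) + t^2
   |w|^2 for all real t. *)
have q1 : rip w (h - u n) ^+ 2 <= q n * nsq w.
  apply: quadratic_discr => [|t]; first exact: nsq_ge0.
  have /d_le : S (u n - t%:C *: w) by apply: subspaceB => //; exact: subspaceZ.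
  rewrite /nsq !ripE in hn *; rewrite !(ripC ip _ h) !(ripC ip (u n) w) in hn *; lra.
have q2 := cauchy_schwarz ip w (l - u n).
have -> : rip w (h - l) = rip w (h - u n) - rip w (l - u n) by rewrite !ripE; lra.
have b1 : q n * nsq w <= d * nsq w by rewrite ler_wpM2r ?nsq_ge0 // ltW.
have b2 : nsq w * nsq (l - u n) <= nsq w * d by rewrite ler_wpM2l ?nsq_ge0 // ltW.
have := sqr_ge0 (rip w (h - u n) + rip w (l - u n)); rewrite -dE; lra.
Qed.

End Completeness.

(** * Selfadjoint relations and their resolvents *)

Section Relations.
Context (R : realType) (V : completeNormedModType R[i]).
Context (ip : {dot V for Num.conj}) (ip_norm : induces_norm ip).
Local Notation rip := (rip ip).
Local Notation nsq := (nsq ip).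
Local Notation subspace := (@subspace R V).
Implicit Types (H : set (V * V)).

Lemma adjoint_subspace H g k g' k' (c : R[i]) :
  adjoint ip H (g, k) -> adjoint ip H (g', k') ->
  adjoint ip H (c *: g + g', c *: k + k').
Proof.
by move=> a a' p q Hpq /=; rewrite !ipE (a _ _ Hpq) (a' _ _ Hpq).
Qed.

Lemma adjoint_closed H g k :
    (forall e, 0 < e -> exists p q,
      [/\ adjoint ip H (p, q), nsq (g - p) < e & nsq (k - q) < e]) ->
  adjoint ip H (g, k).
Proof.
move=> lim f l Hfl; apply: ip_eq_lim => e /lim [p [q [Apq gp kq]]].
by exists p, q; split => //; exact: Apq.
Qed.

Section SelfAdjoint.
Context (H : set (V * V)) (saH : selfadjoint_operator ip H).

Lemma sa_comb g k g' k' (c : R[i]) :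
  H (g, k) -> H (g', k') -> H (c *: g + g', c *: k + k').
Proof. by case: saH => -> _; exact: adjoint_subspace. Qed.

Lemma sa0 : H (0, 0).
Proof. by case: saH => -> _ f g _; rewrite !ip0r. Qed.

Lemma saD g k g' k' : H (g, k) -> H (g', k') -> H (g + g', k + k').
Proof. by move=> h h'; have := sa_comb 1 h h'; rewrite !scale1r. Qed.

Lemma saZ g k (c : R[i]) : H (g, k) -> H (c *: g, c *: k).
Proof. by move=> h; have := sa_comb c h sa0; rewrite !addr0. Qed.

Lemma saB g k g' k' : H (g, k) -> H (g', k') -> H (g - g', k - k').
Proof.
by move=> h h'; rewrite -(scaleN1r g') -(scaleN1r k'); apply: saD => //; exact: saZ.
Qed.

Lemma sa_fun g k k' : H (g, k) -> H (g, k') -> k = k'.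
Proof.
move=> h h'; apply/eqP; rewrite -subr_eq0; apply/eqP.
case: saH => _ mulH; have : rel_mul H (k - k').
  by rewrite /rel_mul /= -(subrr g); exact: saB.
by rewrite mulH.
Qed.

Lemma sa_sym g k g' k' : H (g, k) -> H (g', k') -> ip k g' = ip g k'.
Proof.
move=> Hgk Hgk'.
have : adjoint ip H (g', k') by case: saH => <-.
by move/(_ _ _ Hgk).
Qed.

Lemma sa_adj g k :
  (forall p q, H (p, q) -> ip q g = ip p k) -> H (g, k).
Proof. by move=> sym; case: saH => -> _. Qed.

Lemma sa_closed g k :
    (forall e, 0 < e -> exists p q,
      [/\ H (p, q), nsq (g - p) < e & nsq (k - q) < e]) ->
  H (g, k).
Proof.
move=> lim; have : adjoint ip H (g, k); last by case: saH => <-.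
apply: adjoint_closed => e /lim [p [q [Hpq gp kq]]].
by exists p, q; split => //; case: saH => <-.
Qed.

(** A vector orthogonal to the domain lies in the multivalued part of the adjoint, which is that of
    H and so trivial. *)
Lemma sa_dense u e : 0 < e -> exists g k, H (g, k) /\ nsq (u - g) < e.
Proof.
pose D : set V := [set g | exists k, H (g, k)].
have sD : subspace D.
  split=> [|c p q [k Hk] [l Hl]]; first by exists 0; exact: sa0.
  by exists (c *: k + l); exact: sa_comb.
have [v Dv orth] := orthogonal_decomposition ip_norm u sD.
suff /eqP : u - v = 0.
  rewrite subr_eq0 => /eqP -> e0.
  by have /(closure_nsq ip_norm) /(_ e e0) [s [k Hk] ?] := Dv; exists s, k.
case: saH => _ mulH; have : rel_mul H (u - v).
  apply: sa_adj => p q Hpq; rewrite ip0r; apply/esym/ip_eq0C.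
  by apply: orth; exists q.
by rewrite mulH.
Qed.

Lemma sa_lower_bound m :
  lower_bounds ip H m <-> forall g k, H (g, k) -> m * nsq g <= rip k g.
Proof.
split=> lb g k Hgk; have := lb g k Hgk; rewrite ip_nsq -rmorphM.
  by rewrite lecE => /andP[].
move=> le; rewrite lecE /= le andbT.
have := ipC ip k g; rewrite -(sa_sym Hgk Hgk).
by case: (ip k g) => a b [] e /=; apply/eqP; lra.
Qed.

(** Coercivity turns convergent values of H - y into Cauchy arguments, so the range is closed
    because H is. A vector orthogonal to the range is an eigenvector of H for the real number y, and
    coercivity makes it 0. *)
Lemma sa_surjective (y c : R) : 0 < c ->
    (forall g k, H (g, k) -> c * nsq g <= nsq (k - y%:C *: g)) ->
  forall f, exists g, H (g, f + y%:C *: g).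
Proof.
move=> c0 coer f.
pose S : set V := [set v | exists g, H (g, v + y%:C *: g)].
have sS : subspace S.
  split=> [|a u v [g Hg] [g' Hg']]; first by exists 0; rewrite scaler0 addr0; exact: sa0.
  exists (a *: g + g'); have := sa_comb a Hg Hg'; congr (H (_, _)).
  by rewrite !scalerDr !scalerA (mulrC a) addrACA.
have [v Sv orth] := orthogonal_decomposition ip_norm f sS.
have [q q0 archi] := null_sequence R.
have [u hu] : {u : nat -> V * V & forall n,
    H ((u n).1, (u n).2 + y%:C *: (u n).1) /\ nsq (v - (u n).2) < q n}.
  apply: (@choice _ _ (fun n p => H (p.1, p.2 + y%:C *: p.1) /\
    nsq (v - p.2) < q n)) => n.
  have /(closure_nsq ip_norm) /(_ _ (q0 n)) [s [g Hg] ?] := Sv.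
  by exists (g, s).
have step n m : c * nsq ((u n).1 - (u m).1) <= nsq ((u n).2 - (u m).2).
  have [[Hn _] [Hm _]] := (hu n, hu m); have := coer _ _ (saB Hn Hm).
  by congr (_ <= nsq _); rewrite scalerBr opprD addrACA addrK.
have [g hg] : exists g, forall e, 0 < e -> exists N, forall n, (N <= n)%N ->
    nsq (g - (u n).1) < e.
  apply: (nsq_complete ip_norm (u := fun n => (u n).1)) => e e0.
  have [N hN] := archi (c * e / 4) (divr_gt0 (mulr_gt0 c0 e0) (ltr0n _ 4)).
  exists N => n m Nn Nm; rewrite -(ltr_pM2l c0); apply: le_lt_trans (step n m) _.
  have [[_ vn] [_ vm]] := (hu n, hu m).
  have -> : (u n).2 - (u m).2 = (v - (u m).2) + - (v - (u n).2).
    by rewrite opprB [RHS]addrC addrA subrK.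
  have := nsqD_le ip (v - (u m).2) (- (v - (u n).2)); rewrite nsqN.
  have := hN n Nn; have := hN m Nm; lra.
have Hgv : H (g, v + y%:C *: g).
  apply: sa_closed => e e0.
  have M0 : 0 < 4 + 4 * y ^+ 2 by have := sqr_ge0 y; lra.
  have d0 := divr_gt0 e0 M0.
  have dE : (4 + 4 * y ^+ 2) * (e / (4 + 4 * y ^+ 2)) = e.
    by rewrite mulrCA divff ?mulr1 // gt_eqF.
  move: (e / _) d0 dE => d d0 dE; have y2 := sqr_ge0 y.
  have [[N hN] [N' hN']] := (hg d d0, archi d d0); set n := maxn N N'.
  have gn := hN n (leq_maxl _ _); have qn := hN' n (leq_maxr _ _).
  have [Hn vn] := hu n; have n1 := nsq_ge0 ip (g - (u n).1).
  have yd : 0 <= y ^+ 2 * d by rewrite mulr_ge0 // ltW.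
  exists (u n).1, ((u n).2 + y%:C *: (u n).1); split => //; first lra.
  rewrite opprD addrACA -scalerBr.
  have := nsqD_le ip (v - (u n).2) (y%:C *: (g - (u n).1)).
  rewrite nsqZ /= expr0n addr0.
  have : y ^+ 2 * nsq (g - (u n).1) <= y ^+ 2 * d by rewrite ler_wpM2l // ltW.
  lra.
exists g; suff -> : f = v by [].
apply/eqP; rewrite -subr_eq0; apply/eqP.
have Hfv : H (f - v, y%:C *: (f - v)).
  apply: sa_adj => p r Hpr; rewrite ipZr conjc_real.
  apply/eqP; rewrite -subr_eq0 -ipZl -ipNl -ipDl; apply/eqP/ip_eq0C/orth.
  by exists p; rewrite subrK.
apply: (@nsq_le0 _ _ ip); rewrite -(pmulr_rle0 _ c0).
by have := coer _ _ Hfv; rewrite subrr nsq0.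
Qed.

(** * The resolvent below a lower bound *)

Section Resolvent.
Context (m x : R) (lbm : lower_bounds ip H m) (xm : x < m).
Local Notation Res := (resolvent H x).

(** Cauchy-Schwarz applied to (m - x) |g|^2 <= ((H - x) g, g). *)
Lemma sa_coercive g k : H (g, k) ->
  (m - x) ^+ 2 * nsq g <= nsq (k - x%:C *: g).
Proof.
move=> Hgk; have := nsq_ge0 ip g; rewrite le0r => /orP[/eqP->|g0].
  by rewrite mulr0 nsq_ge0.
have mx : 0 < m - x by rewrite subr_gt0.
have lo : (m - x) * nsq g <= rip (k - x%:C *: g) g.
  by move/sa_lower_bound : lbm => /(_ _ _ Hgk); rewrite !ripE /nsq; lra.
rewrite -(ler_pM2r g0); apply: le_trans (cauchy_schwarz _ _ _).
apply: le_trans (_ : ((m - x) * nsq g) ^+ 2 <= _); first lra.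
have lo0 : 0 <= (m - x) * nsq g by rewrite mulr_ge0 ?ltW.
by rewrite ler_sqr ?nnegrE // (le_trans lo0 lo).
Qed.

Lemma resolventP f : H (Res f, f + x%:C *: Res f).
Proof.
have mx : 0 < (m - x) ^+ 2 by rewrite exprn_gt0 // subr_gt0.
have [g Hg] := sa_surjective mx sa_coercive f.
exact: (xgetI (P := [set k | rel_inv (rel_shift H x) (f, k)]) 0 Hg).
Qed.

Lemma resolvent_unique g f : H (g, f + x%:C *: g) -> g = Res f.
Proof.
move=> Hg; have := sa_coercive (saB Hg (resolventP f)).
rewrite opprD addrACA subrr add0r -scalerBr subrr nsq0 pmulr_rle0.
  by move/nsq_le0/eqP; rewrite subr_eq0 => /eqP.
by rewrite exprn_gt0 // subr_gt0.
Qed.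

Lemma resolvent_linear (c : R[i]) f f' : Res (c *: f + f') = c *: Res f + Res f'.
Proof.
apply/esym/resolvent_unique; have := sa_comb c (resolventP f) (resolventP f').
by rewrite !scalerDr !scalerA (mulrC c) addrACA.
Qed.

Lemma resolvent_sym f f' : ip (Res f) f' = ip f (Res f').
Proof.
have := sa_sym (resolventP f) (resolventP f').
rewrite !ipE conjc_real => /eqP; rewrite -subr_eq0 opprD addrACA subrr addr0.
by rewrite subr_eq0 => /eqP.
Qed.

Lemma resolvent_ge0 f : 0 <= rip (Res f) f.
Proof.
have := resolventP f; move/sa_lower_bound : lbm => /[apply].
have := nsq_ge0 ip (Res f); rewrite !ripE (ripC ip f) -/(nsq _) => n0 lo.
have : 0 <= (m - x) * nsq (Res f) by rewrite mulr_ge0 // subr_ge0 ltW.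
lra.
Qed.

Lemma resolvent_real f : ip (Res f) f = (rip (Res f) f)%:C.
Proof.
have := ipC ip (Res f) f; rewrite -resolvent_sym /rip.
by case: (ip _ _) => a b [] e; congr (_ +i* _); lra.
Qed.

End Resolvent.
End SelfAdjoint.

Definition resolvent_le H1 H2 (x : R) : Prop :=
  forall h, rip (resolvent H2 x h) h <= rip (resolvent H1 x h) h.

Lemma lower_boundP H (x : R) :
  (x%:E < lower_bound ip H)%E <-> exists2 m, lower_bounds ip H m & x < m.
Proof.
split=> [/ereal_sup_gt [_ [m lbm <-]]|[m lbm xm]]; first by rewrite lte_fin; exists m.
apply: (@lt_le_trans _ _ m%:E); first by rewrite lte_fin.
by apply: ereal_sup_ubound; exists m.
Qed.

(** Below a lower bound the resolvent form is real and nonnegative, so only an inequality between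
    real parts remains of the order. *)
Lemma op_leP H1 H2 : selfadjoint_operator ip H1 -> selfadjoint_operator ip H2 ->
  op_le ip H1 H2 <-> exists x m1 m2, [/\ lower_bounds ip H1 m1, x < m1,
    lower_bounds ip H2 m2, x < m2 & resolvent_le H1 H2 x].
Proof.
move=> sa1 sa2; split=> [[x]|[x [m1 [m2 [lb1 xm1 lb2 xm2 le12]]]]].
  rewrite lt_min => /andP[/lower_boundP [m1 lb1 xm1] /lower_boundP [m2 lb2 xm2]] le12.
  exists x, m1, m2; split => // h; have /andP[_] := le12 h.
  by rewrite (resolvent_real sa1 lb1) // (resolvent_real sa2 lb2) // lecR.
exists x; first by rewrite lt_min; apply/andP; split; apply/lower_boundP;
  [exists m1|exists m2].
move=> h; rewrite (resolvent_real sa1 lb1) // (resolvent_real sa2 lb2) //.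
by rewrite !lecR le12 (resolvent_ge0 sa2 lb2).
Qed.

End Relations.

(** * Finite-dimensional negative subspaces of hermitian forms *)

Section Dimension.
Context (R : realType) (V : normedModType R[i]).
Local Notation subspace := (@subspace R V).
Implicit Types (S T : set V).

Definition span n (b : 'I_n -> V) : set V :=
  [set v | exists c : 'I_n -> R[i], v = \sum_i c i *: b i].

Definition fcons n (v : V) (b : 'I_n -> V) (i : 'I_n.+1) : V :=
  if unlift ord0 i is Some j then b j else v.

Lemma sum_fcons n v (b : 'I_n -> V) (c : 'I_n.+1 -> R[i]) :
  \sum_i c i *: fcons v b i =
  c ord0 *: v + \sum_i c (lift ord0 i) *: b i.
Proof.
rewrite big_ord_recl /fcons unlift_none; congr (_ + _).
by apply: eq_bigr => i _; rewrite liftK.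
Qed.

Lemma spanP n (b : 'I_n.+1 -> V) v :
  span b v <-> exists c w, span (b \o lift ord0) w /\ v = w + c *: b ord0.
Proof.
split=> [[c ->]|[c [_ [[d ->] ->]]]].
  rewrite big_ord_recl addrC; exists (c ord0); eexists; split; last by [].
  by exists (c \o lift ord0).
exists (fun i => if unlift ord0 i is Some j then d j else c).
rewrite big_ord_recl unlift_none addrC; congr (_ + _).
by apply: eq_bigr => i _ /=; rewrite liftK.
Qed.

Lemma span_subspace n (b : 'I_n -> V) : subspace (span b).
Proof.
split=> [|c _ _ [d ->] [d' ->]].
  by exists (fun=> 0); rewrite big1 // => i _; rewrite scale0r.
exists (fun i => c * d i + d' i); rewrite scaler_sumr -big_split /=.
by apply: eq_bigr => i _; rewrite scalerA scalerDl.
Qed.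

Lemma sub_span n (b : 'I_n -> V) S : subspace S -> (forall i, S (b i)) ->
  span b `<=` S.
Proof.
move=> sS Sb _ [c ->]; elim/big_ind: _ => [|u v|i _]; first by case: sS.
  exact: subspaceD.
exact: subspaceZ.
Qed.

Lemma lin_indep_fcons n v (b : 'I_n -> V) :
  lin_indep b -> ~ span b v -> lin_indep (fcons v b).
Proof.
move=> indb vb c; rewrite sum_fcons => c0.
have c00 : c ord0 = 0.
  apply/eqP/negPn/negP => cn0; apply: vb.
  exists (fun i => - (c ord0)^-1 * c (lift ord0 i)).
  under eq_bigr do rewrite -scalerA; rewrite -scaler_sumr.
  apply: (scalerI cn0); rewrite scalerA mulrN divff // scaleN1r.
  by apply/eqP; rewrite -addr_eq0 c0.
move: c0; rewrite c00 scale0r add0r => /indb c1 i.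
by case: (unliftP ord0 i) => [j|] ->.
Qed.

Lemma subspace_dim_ge n (b : 'I_n -> V) S :
  (forall i, S (b i)) -> lin_indep b -> (n%:R%:E <= subspace_dim S)%E.
Proof. by move=> Sb indb; apply: ereal_sup_ubound; exists n => //; exists b. Qed.

Lemma subspace_dim_ge0 S : (0 <= subspace_dim S)%E.
Proof. by apply: (@subspace_dim_ge 0 (fun=> 0)) => [[]|c _ []]. Qed.

Lemma subspace_dim_le S (d : \bar R) :
  (forall n (b : 'I_n -> V), (forall i, S (b i)) -> lin_indep b ->
    (n%:R%:E <= d)%E) -> (subspace_dim S <= d)%E.
Proof. by move=> h; apply: ge_ereal_sup => _ [n [b Sb indb] <-]; exact: h. Qed.

(** An independent family of maximal size spans; the finite supremum bounds the sizes. *)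
Lemma finite_basis S : subspace S -> (subspace_dim S < +oo)%E ->
  exists n (b : 'I_n -> V), [/\ lin_indep b, span b = S &
    subspace_dim S = n%:R%:E].
Proof.
move=> sS finS.
have [r dimS] : exists r, subspace_dim S = r%:E.
  by have := subspace_dim_ge0 S; case: (subspace_dim S) finS => // r; exists r.
pose P n := `[< exists2 b : 'I_n -> V, (forall i, S (b i)) & lin_indep b >].
have P0 : exists n, P n.
  by exists 0%N; apply/asboolP; exists (fun=> 0) => [[]|c _ []].
have Pub n : P n -> (n <= Num.truncn r)%N.
  move=> /asboolP [b Sb indb]; have := subspace_dim_ge Sb indb.
  rewrite dimS lee_fin => nr; rewrite -ltnS -(ltr_nat R).
  exact: le_lt_trans nr (Num.Theory.truncnS_gt _).
case: (ex_maxnP P0 Pub) => n /asboolP [b Sb indb] nmax.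
exists n, b; split => //.
  apply/seteqP; split; first exact: sub_span.
  move=> v Sv; apply: contrapT => nv.
  have /nmax : P n.+1; last by rewrite ltnn.
  apply/asboolP; exists (fcons v b); last exact: lin_indep_fcons.
  by move=> i; rewrite /fcons; case: unlift.
apply/le_anti/andP; split; last exact: subspace_dim_ge Sb indb.
apply: subspace_dim_le.
by move=> m b' Sb' ind'; rewrite lee_fin ler_nat; apply/nmax/asboolP; exists b'.
Qed.

Section LinearFunction.
Context (f : V -> V) (linf : linear f).

Lemma linD u v : f (u + v) = f u + f v.
Proof. by have := linf 1 u v; rewrite !scale1r. Qed.

Lemma lin0 : f 0 = 0.
Proof. by apply: (@addrI _ (f 0)); rewrite -linD !addr0. Qed.

Lemma linZ (c : R[i]) u : f (c *: u) = c *: f u.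
Proof. by have := linf c u 0; rewrite lin0 !addr0. Qed.

Lemma linB u v : f (u - v) = f u - f v.
Proof. by rewrite linD -scaleN1r linZ scaleN1r. Qed.

Lemma lin_comb n (c : 'I_n -> R[i]) (b : 'I_n -> V) :
  f (\sum_i c i *: b i) = \sum_i c i *: f (b i).
Proof.
by rewrite (big_morph f linD lin0); apply: eq_bigr => i _; rewrite linZ.
Qed.

Lemma range_subspace : subspace (range f).
Proof.
split; first by exists 0; rewrite ?lin0.
by move=> c _ _ [u _ <-] [v _ <-]; exists (c *: u + v); rewrite ?linf.
Qed.

Lemma subspace_dim_inj S T : subspace S ->
  (forall v, S v -> T (f v)) -> (forall v, S v -> f v = 0 -> v = 0) ->
  (subspace_dim S <= subspace_dim T)%E.
Proof.
move=> sS fST f0; apply: subspace_dim_le => n b Sb indb.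
apply: (@subspace_dim_ge _ (f \o b)) => [i|c]; first exact/fST/Sb.
rewrite -lin_comb => /f0 h; apply/indb/h/(sub_span sS Sb).
by exists c.
Qed.

End LinearFunction.
End Dimension.

(** * Hermitian forms and the comparison of two of them *)

Section Forms.
Context (R : realType) (V : normedModType R[i]) (ip : {dot V for Num.conj}).
Local Notation rip := (rip ip).
Local Notation nsq := (nsq ip).
Local Notation subspace := (@subspace R V).
Implicit Types (S T : set V) (A B : V -> V).

Definition hermitian_op A := linear A /\ forall u v, ip (A u) v = ip u (A v).

Definition negative_on A S := forall v, S v -> v != 0 -> rip (A v) v < 0.

(** For A definite on S, this is the existence of the A-orthogonal projection onto S. *)
Definition complemented A S :=
  forall h, exists2 n, S n & forall m, S m -> ip (A (h - n)) m = 0.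

Lemma hermitian_rip A u v : hermitian_op A -> rip (A u) v = rip (A v) u.
Proof. by move=> [_ sA]; rewrite [RHS]ripC /rip sA. Qed.

Lemma quad_sqnorm A (c : R[i]) v : hermitian_op A ->
  rip (A (c *: v)) (c *: v) =
  (complex.Re c ^+ 2 + complex.Im c ^+ 2) * rip (A v) v.
Proof.
move=> [linA sA]; rewrite (linZ linA) /rip ipZl ipZr.
have : complex.Im (ip (A v) v) = 0.
  by have := ipC ip (A v) v; rewrite -sA; case: (ip _ _) => a b [] /=; lra.
by case: c (ip (A v) v) => a b [p q] /= ->; ring.
Qed.

(** Gram-Schmidt for the form of A, by induction on the number of generators: each new generator is
    made A-orthogonal to the span of the others. This yields the uniform bound without a compactness
    argument. *)
Lemma negative_span n (b : 'I_n -> V) A : hermitian_op A ->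
    negative_on A (span b) ->
  complemented A (span b) /\
  exists2 e, 0 < e & forall v, span b v -> rip (A v) v <= - e * nsq v.
Proof.
move=> hA; have [linA sA] := hA; elim: n b => [|n IHn] b neg.
  have span0 v : span b v -> v = 0 by case=> c ->; rewrite big_ord0.
  split=> [h|]; first by exists 0; [exact: (span_subspace b).1|move=> m /span0->; rewrite ip0r].
  by exists 1 => // v /span0 ->; rewrite rip0r nsq0 mulr0.
set D := span (b \o lift ord0); set v := b ord0.
have sD : subspace D := span_subspace _.
have spanD w c : D w -> span b (w + c *: v) by move=> Dw; apply/spanP; exists c, w.
have [orthD [e e0 coer]] : complemented A D /\
    exists2 e, 0 < e & forall v, D v -> rip (A v) v <= - e * nsq v.
  by apply: IHn => w Dw; apply: neg; have := spanD w 0 Dw; rewrite scale0r addr0.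
have [n0 Dn0 orth0] := orthD v; have [v' v'E] : {v' | v' = v - n0} by exists (v - n0).
rewrite -v'E in orth0.
have spanE m : span b m -> exists2 w, D w & exists c, m = w + c *: v'.
  move=> /spanP [c [w [Dw ->]]]; exists (w + c *: n0).
    by apply: subspaceD => //; exact: subspaceZ.
  by exists c; rewrite v'E scalerBr addrA [w + _ + _]addrAC addrK.
have span_v' w c : D w -> span b (w + c *: v').
  move=> Dw; rewrite v'E scalerBr addrCA addrC; apply: spanD.
  by apply: subspaceB => //; exact: subspaceZ.
(* The generators may be dependent; a vanishing remainder adds nothing to the span. *)
have [v'0|v'n0] := eqVneq v' 0.
  have subD m : span b m -> D m.
    by move=> /spanE [w Dw [c ->]]; rewrite v'0 scaler0 addr0.
  split; last by exists e => // m /subD; exact: coer.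
  move=> h; have [n1 Dn1 orth1] := orthD h.
  exists n1 => [|m /subD]; last exact: orth1.
  by have := span_v' n1 0 Dn1; rewrite scale0r addr0.
have av' : rip (A v') v' < 0.
  apply: neg => //; have := span_v' 0 1 sD.1; by rewrite add0r scale1r.
have ipv' : ip (A v') v' != 0.
  by apply: contraTneq av'; rewrite /rip => ->; rewrite ltxx.
have orth0' w : D w -> ip (A w) v' = 0.
  by move=> Dw; rewrite sA; apply/ip_eq0C/orth0.
split=> [h|].
  have [n1 Dn1 orth1] := orthD h.
  set l := ip (A (h - n1)) v' / ip (A v') v'.
  exists (n1 + l *: v') => [|m /spanE [w Dw [c ->]]]; first exact: span_v'.
  rewrite opprD addrA (linB linA) (linZ linA) !ipE orth1 // orth0 // /l.
  by field.
have n' : 0 < nsq v' by exact: nsq_gt0.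
set eta := - rip (A v') v' / nsq v'.
have eta0 : 0 < eta by rewrite divr_gt0 // oppr_gt0.
have etaE : rip (A v') v' = - eta * nsq v' by rewrite mulNr divfK ?gt_eqF // opprK.
(* The factor 1/2 absorbs |w + c v'|^2 <= 2 |w|^2 + 2 |c v'|^2, since w and v' are orthogonal for A
   only. *)
exists (Num.min e eta / 2) => [|_ /spanE [w Dw [c ->]]].
  by rewrite divr_gt0 // lt_min e0.
have cross : rip (A w) (c *: v') = 0 by rewrite /rip ipZr orth0' // mulr0.
have := nsqD_le ip w (c *: v'); have := coer w Dw.
rewrite (linD linA) !ripDl !ripDr (hermitian_rip (c *: v') w hA) cross.
rewrite quad_sqnorm // etaE addr0 add0r nsqZ.
set k := _ ^+ 2 + _ ^+ 2; have k0 : 0 <= k by rewrite addr_ge0 ?sqr_ge0.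
have p0 : 0 <= nsq w := nsq_ge0 ip w.
have kn : 0 <= k * nsq v' by rewrite mulr_ge0 // ltW.
have : Num.min e eta * nsq w <= e * nsq w by rewrite ler_wpM2r // ge_min lexx.
have : Num.min e eta * (k * nsq v') <= eta * (k * nsq v').
  by rewrite ler_wpM2r // ge_min lexx orbT.
have : 0 <= Num.min e eta by rewrite le_min !ltW.
move: (nsq (w + _)) (Num.min _ _) => N mu mu0 h1 h2 h3 h4.
have : mu * N <= mu * (2 * nsq w + 2 * (k * nsq v')) by rewrite ler_wpM2l.
lra.
Qed.

(* Otherwise Q would map the sum of S and the line through h injectively into
   its range. *)
Lemma maximal_negative A (Q : V -> V) S h : hermitian_op A -> linear Q ->
    (forall v, Q v = 0 -> 0 <= rip (A v) v) ->
    subspace S -> (subspace_dim (range Q) <= subspace_dim S < +oo)%E ->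
    negative_on A S -> (forall m, S m -> ip (A h) m = 0) ->
  0 <= rip (A h) h.
Proof.
move=> hA linQ posQ sS /andP[dimQ finS] neg orth; rewrite leNgt; apply/negP => ah.
have [linA _] := hA; have [n [b [indb spanb dimS]]] := finite_basis sS finS.
have nSh : ~ span b h.
  by rewrite spanb => /orth; move: ah; rewrite /rip => + h0; rewrite h0 ltxx.
have ind := lin_indep_fcons indb nSh.
have : (n.+1%:R%:E <= subspace_dim (range Q))%E.
  apply: (@le_trans _ _ (subspace_dim (span (fcons h b)))).
    apply: subspace_dim_ge ind => i; exists (fun j => (j == i)%:R).
    rewrite (bigD1 i) //= eqxx scale1r big1 ?addr0 // => j /negPf->.
    by rewrite scale0r.
  apply: (subspace_dim_inj linQ) => [|v _|v]; first exact: span_subspace.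
    by exists v.
  case=> c ->; rewrite sum_fcons; set s := (X in _ + X).
  have Ss : S s by rewrite -spanb; exists (c \o lift ord0).
  move=> /posQ; set l := c ord0.
  have orths : rip (A (l *: h)) s = 0.
    by rewrite (linZ linA) /rip ipZl orth // mulr0.
  rewrite (linD linA) !ripDl !ripDr orths hermitian_rip // orths addr0 add0r.
  rewrite quad_sqnorm //; set k := _ ^+ 2 + _ ^+ 2.
  have k0 : 0 <= k by rewrite addr_ge0 ?sqr_ge0.
  have kh : k * rip (A h) h <= 0 by rewrite mulr_ge0_le0 // ltW.
  (* The form at l h + s is k (A h, h) + (A s, s), with both terms nonpositive; being nonnegative,
     it forces s = 0 and then l = 0. *)
  have [->|/(neg _ Ss) s0] := eqVneq s 0; last first.
    by move=> nn; exfalso; move: kh s0 nn; clear; lra.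
  rewrite rip0r addr0 addr0 => kh'.
  have : k == 0 by move: kh'; rewrite nmulr_lge0 // => kn; rewrite eq_le kn.
  rewrite paddr_eq0 ?sqr_ge0 // !sqrf_eq0 => /andP[/eqP r0 /eqP i0].
  have -> : l = 0 by apply/eqP; rewrite eq_complex r0 i0 /= eqxx.
  by rewrite scale0r.
move=> /le_trans /(_ dimQ); rewrite dimS lee_fin ler_nat ltnn; by [].
Qed.

(* For w = v - n with n in S chosen such that A (w - u) is orthogonal to S,
   (u, f) = 2 Re (f, w) - (A w, w) + (A (w - u), w - u)
          >= 2 Re (f, w) - (B w, w) = (v, f) - (B n, n). *)
Lemma inverse_antitone A B S u v f : hermitian_op A -> hermitian_op B ->
    (forall h, rip (A h) h <= rip (B h) h) ->
    subspace S -> complemented A S -> (forall n, S n -> rip (B n) n <= 0) ->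
    (forall h, (forall m, S m -> ip (A h) m = 0) -> 0 <= rip (A h) h) ->
    A u = f -> B v = f ->
  rip v f <= rip u f.
Proof.
move=> hA hB AB sS compl negB posA Au Bv.
have [linA _] := hA; have [linB' _] := hB.
have [n Sn /posA] := compl (v - u).
have -> : v - u - n = (v - n) - u by rewrite addrAC.
have bw : rip (B (v - n)) (v - n) = rip f v - 2 * rip f n + rip (B n) n.
  by rewrite (linB linB') Bv !ripE (hermitian_rip n v hB) Bv; ring.
have fw : rip f (v - n) = rip f v - rip f n by rewrite !ripE.
have := negB n Sn; have := AB (v - n); rewrite bw.
move: (v - n) fw => w fw; rewrite (linB linA) Au !ripE (hermitian_rip w u hA) Au.
rewrite !(ripC ip _ f) fw; lra.
Qed.

(** Let n be the A-projection of k onto S. As B k = 0, 0 <= (A (k - n), k - n) <= (B n, n), so n =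
    0. Then k is isotropic in the A-complement of S, where A >= 0, and Cauchy-Schwarz for A gives A
    k = 0. *)
Lemma kernel_antitone A B S k : hermitian_op A -> hermitian_op B ->
    (forall h, rip (A h) h <= rip (B h) h) ->
    subspace S -> complemented A S -> negative_on B S ->
    (forall h, (forall m, S m -> ip (A h) m = 0) -> 0 <= rip (A h) h) ->
    B k = 0 ->
  A k = 0.
Proof.
move=> hA hB AB sS compl negB posA Bk.
have [linA sA] := hA; have [linB' _] := hB.
have [n Sn orth] := compl k.
have n0 : n = 0.
  apply/eqP/negPn/negP => /(negB _ Sn).
  have := le_trans (posA _ orth) (AB _).
  rewrite (linB linB') Bk sub0r !ripE (hermitian_rip n k hB) Bk rip0l; lra.
rewrite n0 subr0 in orth.
have ak : rip (A k) k = 0.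
  by apply/le_anti; rewrite posA // andbT (le_trans (AB k)) // Bk rip0l.
suff Ak h : ip (A k) h = 0 by apply: (@nsq_le0 _ _ ip); rewrite /nsq /rip Ak.
have [s Ss orths] := compl h; rewrite -[h](subrK s) ipDr (orth _ Ss) addr0.
apply: ip_eq0 => c; apply/eqP; rewrite -sqrf_eq0; apply/eqP/le_anti.
(* [quadratic_discr] with third coefficient 0: a function affine in t and nonnegative for all t is
   constant. *)
rewrite sqr_ge0 andbT -(mulr0 (rip (A (h - s)) (h - s))).
apply: quadratic_discr => // t; rewrite mulr0 addr0.
have := posA (h - s + t%:C *: (c *: k)) _; rewrite (linD linA (h - s)) !(linZ linA).
have -> : rip (A (h - s) + t%:C *: (c *: A k)) (h - s + t%:C *: (c *: k)) =
    rip (A (h - s)) (h - s) + 2 * t * rip (c *: A k) (h - s).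
  have := quad_sqnorm c k hA; rewrite ak mulr0 (linZ linA) => q0.
  have := hermitian_rip (h - s) (c *: k) hA; rewrite (linZ linA) => e.
  by rewrite !ripDl !ripDr !ripZl !ripZr q0 e; ring.
by apply=> m Sm; rewrite !ipE orth // orths // !mulr0 addr0.
Qed.

End Forms.

(** * Reducing projections and signs of forms *)

Section SpectralSigns.
Context (R : realType) (V : completeNormedModType R[i]).
Context (ip : {dot V for Num.conj}) (ip_norm : induces_norm ip).
Local Notation rip := (rip ip).
Local Notation nsq := (nsq ip).
Implicit Types (H : set (V * V)) (Q : V -> V).

Definition reduces Q H :=
  orthogonal_projection ip Q /\ forall g k, H (g, k) -> H (Q g, Q k).

Lemma reduces_compl Q H : selfadjoint_operator ip H -> reduces Q H ->
  reduces (fun h => h - Q h) H.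
Proof.
move=> saH [[linQ QQ symQ] QH]; split; last by move=> g k Hgk; apply: (saB saH) => //; exact: QH.
split=> [c u v|h|h k].
- by rewrite linQ scalerBr opprD addrACA.
- by rewrite (linB linQ) QQ subrr subr0.
- by rewrite !ipE symQ.
Qed.

(* The bounded operator (H - y) (H - x)^-1. *)
Definition shift_quot H (x y : R) h : V := h - (y - x)%:C *: resolvent H x h.

Section Shift.
Context (H : set (V * V)) (saH : selfadjoint_operator ip H).
Context (m x y : R) (lbm : lower_bounds ip H m) (xm : x < m).
Local Notation Res := (resolvent H x).
Local Notation A := (shift_quot H x y).

Lemma shift_quot_hermitian : hermitian_op ip A.
Proof.
split=> [c u v|u v]; rewrite /shift_quot.
  rewrite (resolvent_linear ip_norm saH lbm) // scalerBr scalerDr !scalerA.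
  by rewrite [c * _]mulrC opprD addrACA.
by rewrite !ipE (resolvent_sym ip_norm saH lbm) // conjc_real.
Qed.

Lemma shift_quotE h : A h = h + x%:C *: Res h - y%:C *: Res h.
Proof. by rewrite /shift_quot rmorphB scalerBl opprB addrA. Qed.

Lemma shift_quotP h : H (Res h, A h + y%:C *: Res h).
Proof. by rewrite shift_quotE subrK; exact: resolventP lbm xm h. Qed.

Lemma resolvent_eq0 h : Res h = 0 -> h = 0.
Proof.
move=> R0; have := resolventP ip_norm saH lbm xm h.
by rewrite R0 scaler0 addr0 => /(sa_fun saH); apply; exact: sa0 saH.
Qed.

Lemma shift_quot_form h :
  rip (A h) h = nsq (A h) + (y - x) * rip (A h) (Res h).
Proof.
have hE : h = A h + (y - x)%:C *: Res h by rewrite subrK.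
by rewrite {2}hE ripDr ripZr.
Qed.

Lemma reduces_resolvent Q h : reduces Q H -> Q h = h -> Q (Res h) = Res h.
Proof.
move=> [[linQ _ _] QH] Qh; apply: (resolvent_unique ip_norm saH lbm) => //.
have := QH _ _ (resolventP ip_norm saH lbm xm h).
by rewrite (linD linQ) (linZ linQ) Qh.
Qed.

Lemma reduces_shift_quot Q h : reduces Q H -> Q h = h -> Q (A h) = A h.
Proof.
move=> rQ Qh; have [[linQ _ _] _] := rQ.
by rewrite (linB linQ) (linZ linQ) (reduces_resolvent rQ Qh) Qh.
Qed.

(** For e in the domain, g = e would do; in general e is approximated by domain vectors. *)
Lemma nsq_dense_le e (C : R) : 0 <= C ->
  (forall g k, H (g, k) -> rip e g ^+ 2 <= C * nsq g) -> nsq e <= C.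
Proof.
move=> C0 bound; rewrite leNgt; apply/negP => Ce.
have p0 : 0 < nsq e by exact: le_lt_trans Ce.
(* With p = |e|^2 and r = |e - g|^2, the estimates end in p (p - C) / 2 <= r (2 (p - C) + C); the
   tolerance on r contradicts this. *)
have M0 : 0 < 2 * (nsq e - C) + C by lra.
have pC : 0 < nsq e * (nsq e - C) / 2 by rewrite divr_gt0 // mulr_gt0 // subr_gt0.
have [g [k [/bound + eg]]] := sa_dense ip_norm saH e (divr_gt0 pC M0).
have := cauchy_schwarz ip e (e - g); have r0 := nsq_ge0 ip (e - g).
rewrite ltr_pdivlMr // in eg.
set a := rip e (e - g).
have -> : rip e g = nsq e - a by rewrite /a /nsq !ripE; ring.
have -> : nsq g = nsq e - 2 * a + nsq (e - g).
  by rewrite /a /nsq !ripE (ripC ip g e); ring.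
move: (nsq e) (nsq (e - g)) a eg r0 Ce p0 pC M0 => p r a eg r0 Ce p0 pC M0 apr b.
have a_le : 2 * a <= p / 2 + 2 * r.
  rewrite leNgt; apply/negP => lt_a.
  have := sqr_ge0 (p / 2 - 2 * r).
  have : (p / 2 + 2 * r) ^+ 2 < (2 * a) ^+ 2.
    by rewrite ltr_sqr ?nnegrE; lra.
  lra.
have : 2 * a * (p - C) <= (p / 2 + 2 * r) * (p - C).
  by rewrite ler_wpM2r // subr_ge0 ltW.
have := sqr_ge0 a; lra.
Qed.

(* Cauchy-Schwarz for the form of y - H on the range of Q gives
   |(H - y) g|^2 <= (y - m) ((y - H) g, g). *)
Lemma shift_quot_nonpos Q h : m <= y -> reduces Q H ->
    (forall g k, H (g, k) -> Q g = g -> rip (k - y%:C *: g) g <= 0) ->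
    Q h = h ->
  rip (A h) h <= (m - x) * rip (A h) (Res h).
Proof.
move=> my rQ neg Qh; rewrite shift_quot_form.
have [[linQ QQ symQ] QH] := rQ.
set e := A h; set g := Res h.
have Qg : Q g = g := reduces_resolvent rQ Qh.
have Qe : Q e = e := reduces_shift_quot rQ Qh.
have Hg : H (g, e + y%:C *: g) := shift_quotP h.
have eg : rip e g <= 0 by have := neg _ _ Hg Qg; rewrite addrK.
suff : nsq e <= - rip e g * (y - m) by lra.
apply: nsq_dense_le => [|k l /[dup] Hkl /QH].
  by rewrite mulr_ge0 ?subr_ge0 // oppr_ge0.
(* The sign of the form is known on the range of Q only. Replacing k by Q k keeps (e, k), as Q e =
   e, and does not increase the norm. *)
set k1 := Q k; set l1 := Q l => Hk1.
have Qk1 : Q k1 = k1 by exact: QQ.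
have -> : rip e k = rip e k1 by rewrite /rip -{1}Qe symQ.
have k1k : nsq k1 <= nsq k.
  have : rip k k1 = nsq k1 by rewrite /nsq /rip /k1 symQ QQ.
  by have := nsq_ge0 ip (k - k1); rewrite /nsq !ripE (ripC ip k1 k); lra.
have nk1 : - rip (l1 - y%:C *: k1) k1 <= (y - m) * nsq k1.
  have /(sa_lower_bound saH) /(_ _ _ Hk1) := lbm.
  by rewrite !ripE /nsq; lra.
apply: (@le_trans _ _ (- rip e g * - rip (l1 - y%:C *: k1) k1)); last first.
  rewrite -[leRHS]mulrA; apply: ler_wpM2l; first by rewrite oppr_ge0.
  by apply: le_trans nk1 _; rewrite ler_wpM2l // subr_ge0.
clearbody e g k1 l1.
rewrite -sqrrN; apply: quadratic_discr => [|t].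
  by rewrite oppr_ge0; exact: neg.
have Hgk := saD saH Hg (saZ saH t%:C Hk1).
have := neg _ _ Hgk; rewrite (linD linQ) (linZ linQ) Qg Qk1 => /(_ erefl).
have l1g : rip l1 g = rip (e + y%:C *: g) k1.
  by rewrite (ripC ip l1) /rip (sa_sym saH Hg Hk1).
by rewrite !ripE (ripC ip k1 g) l1g !ripE; lra.
Qed.

Lemma shift_quot_nonneg Q h : reduces Q H ->
    (forall g k, H (g, k) -> Q g = g -> 0 <= rip (k - y%:C *: g) g) ->
    Q h = h ->
  (y - x) * rip (A h) (Res h) <= rip (A h) h /\ 0 <= rip (A h) (Res h).
Proof.
move=> rQ pos Qh; rewrite shift_quot_form.
have := pos _ _ (shift_quotP h) (reduces_resolvent rQ Qh); rewrite addrK => eg.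
by split => //; have := nsq_ge0 ip (A h); lra.
Qed.

End Shift.

(** The properties of the spectral projection for (-oo, y) that the argument uses. In terms of
    signs, one projection can serve H, H^+ and every y in a spectral gap. *)
Record neg_split H (y : R) Q : Prop := NegSplit {
  neg_reduces : reduces Q H;
  neg_lt0 : forall g k, H (g, k) -> Q g = g -> g != 0 ->
    rip (k - y%:C *: g) g < 0;
  neg_ge0 : forall g k, H (g, k) -> Q g = 0 -> 0 <= rip (k - y%:C *: g) g }.

Record pos_split H (y : R) Q : Prop := PosSplit {
  pos_reduces : reduces Q H;
  pos_gt0 : forall g k, H (g, k) -> Q g = g -> g != 0 ->
    0 < rip (k - y%:C *: g) g;
  pos_le0 : forall g k, H (g, k) -> Q g = 0 -> rip (k - y%:C *: g) g <= 0 }.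

Section Split.
Context (H : set (V * V)) (saH : selfadjoint_operator ip H).
Context (m x y : R) (lbm : lower_bounds ip H m) (xm : x < m) (xy : x < y).
Local Notation Res := (resolvent H x).
Local Notation A := (shift_quot H x y).

(** Provides the condition m <= y of [shift_quot_nonpos]. *)
Lemma lower_bounds_min : lower_bounds ip H (Num.min m y).
Proof.
apply/(sa_lower_bound saH) => g k Hgk.
have /(sa_lower_bound saH) /(_ _ _ Hgk) := lbm; apply: le_trans.
by rewrite ler_wpM2r ?nsq_ge0 // ge_min lexx.
Qed.

Lemma proj_compl_fix Q (h : V) : linear Q -> h - Q h = h <-> Q h = 0.
Proof.
move=> linQ; split=> [/eqP|->]; last by rewrite subr0.
by rewrite -subr_eq0 addrAC subrr sub0r oppr_eq0 => /eqP.
Qed.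

Lemma proj_range Q (h : V) : (forall h, Q (Q h) = Q h) -> range Q h <-> Q h = h.
Proof. by move=> QQ; split=> [[g _ <-]|Qh]; [exact: QQ|exists h]. Qed.

Let xmin : x < Num.min m y. Proof. by rewrite lt_min xm. Qed.
Let miny : Num.min m y <= y. Proof. by rewrite ge_min lexx orbT. Qed.

Lemma resolvent_neq0 h : h != 0 -> Res h != 0.
Proof. by apply: contra_neq => /(resolvent_eq0 saH lbm xm). Qed.

(** With g = (H - x)^-1 h one has (A h, g) = ((H - y) g, g), and the estimates for [shift_quot]
    carry its sign over to (A h, h). *)
Lemma neg_split_quot Q : neg_split H y Q ->
  negative_on ip A (range Q) /\ forall h, Q h = 0 -> 0 <= rip (A h) h.
Proof.
case=> rQ neg pos; have [[linQ QQ _] _] := rQ.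
split=> [h /(proj_range _ QQ) Qh h0|h Qh].
  have neg' g k : H (g, k) -> Q g = g -> rip (k - y%:C *: g) g <= 0.
    move=> Hgk Qg; have [->|g0] := eqVneq g 0; first by rewrite rip0r.
    exact/ltW/neg.
  apply: le_lt_trans (shift_quot_nonpos saH lower_bounds_min xmin miny rQ neg' Qh) _.
  rewrite pmulr_rlt0 ?subr_gt0 //.
  have := neg _ _ (shift_quotP saH y lbm xm h) (reduces_resolvent saH lbm xm rQ Qh).
  by rewrite addrK; apply; exact: resolvent_neq0.
have rQ' := reduces_compl saH rQ.
have pos' g k : H (g, k) -> g - Q g = g -> 0 <= rip (k - y%:C *: g) g.
  by move=> Hgk /(proj_compl_fix _ linQ); exact: pos.
have /(proj_compl_fix _ linQ) Q'h := Qh.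
have [le_h ge0] := shift_quot_nonneg saH lbm xm rQ' pos' Q'h.
by apply: le_trans le_h; rewrite mulr_ge0 // subr_ge0 ltW.
Qed.

Lemma pos_split_quot Q : pos_split H y Q ->
  (forall h, Q h = h -> h != 0 -> 0 < rip (A h) h) /\
  forall h, Q h = 0 -> rip (A h) h <= 0.
Proof.
case=> rQ pos neg; have [[linQ QQ _] _] := rQ; split=> [h Qh h0|h Qh].
  have pos' g k : H (g, k) -> Q g = g -> 0 <= rip (k - y%:C *: g) g.
    move=> Hgk Qg; have [->|g0] := eqVneq g 0; first by rewrite rip0r.
    exact/ltW/pos.
  have [le_h _] := shift_quot_nonneg saH lbm xm rQ pos' Qh.
  apply: lt_le_trans le_h; rewrite mulr_gt0 ?subr_gt0 //.
  have := pos _ _ (shift_quotP saH y lbm xm h) (reduces_resolvent saH lbm xm rQ Qh).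
  by rewrite addrK; apply; exact: resolvent_neq0.
have rQ' := reduces_compl saH rQ.
have neg' g k : H (g, k) -> g - Q g = g -> rip (k - y%:C *: g) g <= 0.
  by move=> Hgk /(proj_compl_fix _ linQ); exact: neg.
have /(proj_compl_fix _ linQ) Q'h := Qh.
apply: le_trans (shift_quot_nonpos saH lower_bounds_min xmin miny rQ' neg' Q'h) _.
rewrite pmulr_rle0 ?subr_gt0 //.
have /(proj_compl_fix _ linQ) QR := reduces_resolvent saH lbm xm rQ' Q'h.
by have := neg _ _ (shift_quotP saH y lbm xm h) QR; rewrite addrK.
Qed.

End Split.
End SpectralSigns.


(** * Consequences of an inequality of resolvents *)

Section Comparison.
Context (R : realType) (V : completeNormedModType R[i]).
Context (ip : {dot V for Num.conj}) (ip_norm : induces_norm ip).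
Local Notation rip := (rip ip).
Local Notation nsq := (nsq ip).
Local Notation subspace := (@subspace R V).
Implicit Types (H : set (V * V)) (Q : V -> V).

Section OneOperator.
Context (H : set (V * V)) (saH : selfadjoint_operator ip H).
Context (m x y : R) (lbm : lower_bounds ip H m) (xm : x < m).

(** The preimage of f is (H - x) g, where (H - y) g = f. *)
Lemma shift_quot_solution g f : H (g, f + y%:C *: g) ->
  shift_quot H x y (f + (y - x)%:C *: g) = f.
Proof.
move=> Hg; have gE : g = resolvent H x (f + (y - x)%:C *: g).
  apply: (resolvent_unique ip_norm saH lbm) => //.
  by rewrite -addrA -scalerDl -rmorphD subrK.
by rewrite /shift_quot -gE addrK.
Qed.

Lemma shift_quot_kernel h : x < y -> shift_quot H x y h = 0 <-> H (h, y%:C *: h).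
Proof.
move=> xy; split=> [|Hh].
  rewrite /shift_quot => /eqP; rewrite subr_eq0 => /eqP hE.
  have := saZ saH (y - x)%:C (resolventP ip_norm saH lbm xm h).
  rewrite -hE scalerDr scalerA mulrC -scalerA -hE -scalerDl -rmorphD subrK.
  by [].
have := @shift_quot_solution h 0; rewrite !add0r => /(_ Hh).
have [linA _] := shift_quot_hermitian ip_norm saH y lbm xm.
rewrite (linZ linA) => /eqP; rewrite scaler_eq0 => /orP[|/eqP //].
by rewrite eq_complex /= eqxx andbT subr_eq0 gt_eqF.
Qed.

End OneOperator.

(** * Two operators whose resolvents are ordered at x *)

Section TwoOperators.
Context (H1 H2 : set (V * V)).
Context (sa1 : selfadjoint_operator ip H1) (sa2 : selfadjoint_operator ip H2).
Context (m1 m2 x : R) (lb1 : lower_bounds ip H1 m1) (lb2 : lower_bounds ip H2 m2).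
Context (xm1 : x < m1) (xm2 : x < m2) (le12 : resolvent_le ip H1 H2 x).

(** (H_j - x0)(H_j - x)^-1 = 1 + (x - x0)(H_j - x)^-1 is nonnegative, so [inverse_antitone] applies
    with S = 0 and the operators exchanged. Its conclusion carries the negative factor x0 - x, which
    restores the order. *)
Lemma resolvent_le_shift x0 : x0 < x -> resolvent_le ip H1 H2 x0.
Proof.
move=> x0x f.
have lt1 := lt_trans x0x xm1; have lt2 := lt_trans x0x xm2.
have S1 := shift_quot_solution sa1 lb1 xm1 (resolventP ip_norm sa1 lb1 lt1 f).
have S2 := shift_quot_solution sa2 lb2 xm2 (resolventP ip_norm sa2 lb2 lt2 f).
have h1 := shift_quot_hermitian ip_norm sa1 x0 lb1 xm1.
have h2 := shift_quot_hermitian ip_norm sa2 x0 lb2 xm2.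
have d0 : 0 < x - x0 by rewrite subr_gt0.
have AB h : rip (shift_quot H2 x x0 h) h <= rip (shift_quot H1 x x0 h) h.
  have := ler_wpM2l (ltW d0) (le12 h); rewrite /shift_quot !ripE; lra.
have s0 : subspace [set 0].
  by split=> // c _ _ -> ->; rewrite scaler0 addr0.
have := inverse_antitone h2 h1 AB s0 _ _ _ S2 S1; rewrite !ripE => key.
suff : (x0 - x) * rip (resolvent H1 x0 f) f <= (x0 - x) * rip (resolvent H2 x0 f) f.
  by rewrite ler_nM2l // subr_lt0.
have : _ := key _ _ _; rewrite lerD2l; apply.
- by move=> h; exists 0 => // _ ->; rewrite ip0r.
- by move=> _ ->; rewrite rip0r.
- move=> h _; have := resolvent_ge0 ip_norm sa2 lb2 xm2 h.
  by have := nsq_ge0 ip h; move=> n0 /(mulr_ge0 (ltW d0)); rewrite /shift_quot !ripE /nsq; lra.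
Qed.

Context (y : R) (xy : x < y).
Local Notation A := (shift_quot H1 x y).
Local Notation B := (shift_quot H2 x y).

Lemma shift_quot_le h : rip (A h) h <= rip (B h) h.
Proof.
have yx : 0 <= y - x by rewrite subr_ge0 ltW.
have := ler_wpM2l yx (le12 h); rewrite /shift_quot !ripE; lra.
Qed.

Let hA : hermitian_op ip A := shift_quot_hermitian ip_norm sa1 y lb1 xm1.
Let hB : hermitian_op ip B := shift_quot_hermitian ip_norm sa2 y lb2 xm2.

(** Q1 is injective on the range of Q2: a nonzero v there with Q1 v = 0 would give 0 <= (A v, v) <=
    (B v, v) < 0. *)
Lemma neg_dim_antitone Q1 Q2 : neg_split ip H1 y Q1 -> neg_split ip H2 y Q2 ->
  (subspace_dim (range Q2) <= subspace_dim (range Q1))%E.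
Proof.
move=> sp1 sp2; have [[[lin1 _ _] _] [[lin2 _ _] _]] := (neg_reduces sp1, neg_reduces sp2).
have [_ posA] := neg_split_quot ip_norm sa1 lb1 xm1 xy sp1.
have [negB _] := neg_split_quot ip_norm sa2 lb2 xm2 xy sp2.
apply: (subspace_dim_inj lin1) => [|v _|v /negB + /posA]; first exact: range_subspace.
  by exists v.
by move=> nz na; apply/eqP/negPn/negP => /nz; have := shift_quot_le v; lra.
Qed.

Lemma pos_dim_monotone Q1 Q2 : pos_split ip H1 y Q1 -> pos_split ip H2 y Q2 ->
  (subspace_dim (range Q1) <= subspace_dim (range Q2))%E.
Proof.
move=> sp1 sp2; have [[[lin1 QQ _] _] [[lin2 _ _] _]] := (pos_reduces sp1, pos_reduces sp2).
have [posA _] := pos_split_quot ip_norm sa1 lb1 xm1 xy sp1.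
have [_ negB] := pos_split_quot ip_norm sa2 lb2 xm2 xy sp2.
apply: (subspace_dim_inj lin2) => [|v _|v /(proj_range _ QQ) /posA + /negB].
- exact: range_subspace.
- by exists v.
by move=> nz na; apply/eqP/negPn/negP => /nz; have := shift_quot_le v; lra.
Qed.

Context (Q1 Q2 : V -> V) (sp1 : neg_split ip H1 y Q1) (sp2 : neg_split ip H2 y Q2).
Context (dim12 : (subspace_dim (range Q1) <= subspace_dim (range Q2) < +oo)%E).

Let sQ2 : subspace (range Q2).
Proof. by apply: range_subspace; case: (neg_reduces sp2) => [[]]. Qed.

Let negB : negative_on ip B (range Q2).
Proof. by case: (neg_split_quot ip_norm sa2 lb2 xm2 xy sp2). Qed.

Let negA : negative_on ip A (range Q2).
Proof. by move=> v Qv /(negB Qv); apply: le_lt_trans; exact: shift_quot_le. Qed.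

Let complA : complemented ip A (range Q2).
Proof.
have /andP[_ fin2] := dim12; have [n [b [_ spanb _]]] := finite_basis sQ2 fin2.
by rewrite -spanb; case: (negative_span (b := b) hA); rewrite ?spanb.
Qed.

(** Here [dim12] enters: it makes the range of Q2 a maximal A-negative subspace. *)
Let posA h : (forall v, range Q2 v -> ip (A h) v = 0) -> 0 <= rip (A h) h.
Proof.
apply: (maximal_negative hA (Q := Q1)) => //.
  by case: (neg_reduces sp1) => [[]].
by case: (neg_split_quot ip_norm sa1 lb1 xm1 xy sp1).
Qed.

Lemma eigenvector_antitone k : H2 (k, y%:C *: k) -> H1 (k, y%:C *: k).
Proof.
move=> /(shift_quot_kernel sa2 lb2 xm2 _ xy) Bk.
apply/(shift_quot_kernel sa1 lb1 xm1 _ xy).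
exact: (kernel_antitone hA hB shift_quot_le sQ2).
Qed.

(** Phrased with solutions of (H_j - y) v_j = f, because y need not lie below the lower bounds,
    where the resolvent lemmas apply. *)
Lemma inverse_shift_antitone f v1 v2 :
  H1 (v1, f + y%:C *: v1) -> H2 (v2, f + y%:C *: v2) -> rip v2 f <= rip v1 f.
Proof.
move=> /(shift_quot_solution sa1 lb1 xm1) S1 /(shift_quot_solution sa2 lb2 xm2) S2.
have negB' n : range Q2 n -> rip (B n) n <= 0.
  move=> Qn; have [->|n0] := eqVneq n 0; first by rewrite rip0r.
  exact/ltW/negB.
have := inverse_antitone hA hB shift_quot_le sQ2 complA negB' posA S1 S2.
by rewrite !ripE lerD2l ler_pM2l // subr_gt0.
Qed.

End TwoOperators.
End Comparison.

(** * Moore-Penrose inverses *)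

Section MoorePenrose.
Context (R : realType) (V : completeNormedModType R[i]).
Context (ip : {dot V for Num.conj}) (ip_norm : induces_norm ip).
Local Notation rip := (rip ip).
Local Notation nsq := (nsq ip).
Local Notation subspace := (@subspace R V).
Local Notation mp H := (mp_inverse ip H).
Context (H : set (V * V)) (saH : selfadjoint_operator ip H).

Lemma kernel_decomposition h : exists z, H (z, 0) /\
  forall z', H (z', 0) -> ip (h - z) z' = 0.
Proof.
have sK : subspace (rel_ker H).
  split=> [|c u v Hu Hv]; first exact: sa0 saH.
  by have := sa_comb saH c Hu Hv; rewrite scaler0 addr0.
have [z clz orth] := orthogonal_decomposition ip_norm h sK.
exists z; split => //; apply: (sa_closed saH) => e e0.
have /(closure_nsq ip_norm) /(_ e e0) [s Hs zs] := clz.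
by exists s, 0; rewrite subrr nsq0.
Qed.

Lemma closure_ran k :
  closure (rel_ran H) k <-> forall z, H (z, 0) -> ip k z = 0.
Proof.
split=> [clk z Hz|orthk].
  apply: ip_eq0C; apply: (closure_orth ip_norm clk) => s [g Hg].
  by rewrite -(sa_sym saH Hz Hg) ip0l.
have sR : subspace (rel_ran H).
  split=> [|c u v [g Hu] [g' Hv]]; first by exists 0; exact: sa0 saH.
  by exists (c *: g + g'); exact: (sa_comb saH).
have [u clu orth] := orthogonal_decomposition ip_norm k sR.
have Hku : H (k - u, 0).
  apply: (sa_adj saH) => p q Hpq; rewrite ip0r; apply/ip_eq0C/orth.
  by exists p.
suff /eqP : k - u = 0 by rewrite subr_eq0 => /eqP ->.
apply: (@nsq_le0 _ _ ip); rewrite /nsq /rip ipDl orthk //.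
rewrite ipNl (_ : ip u (k - u) = 0) ?subrr //.
by apply: ip_eq0C; exact: (closure_orth ip_norm clu orth).
Qed.

(** The closure of the range is the orthogonal complement of the kernel, so each projection in P
    H^-1 P removes a kernel component. *)
Lemma mp_inverseP f g : mp H (f, g) <->
  (exists2 z, H (z, 0) & H (g, f - z)) /\ forall z, H (z, 0) -> ip g z = 0.
Proof.
split.
  case=> w [u [/= clu orthu] Hwu] [/= /closure_ran clg orthg].
  have Hfu : H (f - u, 0).
    apply: (sa_adj saH) => p q Hpq; rewrite ip0r; apply/ip_eq0C/orthu.
    by exists p.
  have Hwg : H (w - g, 0).
    apply: (sa_adj saH) => p q Hpq; rewrite ip0r; apply/ip_eq0C/orthg.
    by exists p.
  split=> //; exists (f - u) => //.
  by have := saB saH Hwu Hwg; rewrite !subKr subr0.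
case=> [[z Hz Hg] orth]; exists g; last first.
  by split=> /= [|s _]; [exact/closure_ran|rewrite subrr ip0l].
exists (f - z) => //; split=> /= [|s [p Hp]].
  by apply: subset_closure; exists g.
by rewrite subKr -(sa_sym saH Hz Hp) ip0l.
Qed.

(** For (p, q) in the adjoint, testing with (z, 0), z in ker H, gives q orthogonal to ker H; testing
    with (k, w - z') for (w, k) in H puts (q, p - z) into the adjoint of H, that is, into H. *)
Lemma mp_inverse_selfadjoint : selfadjoint_operator ip (mp H).
Proof.
split; last first.
  apply/seteqP; split=> [g /mp_inverseP [[z Hz Hg] orth]|_ ->] /=.
    have z0 : z = 0.
      apply: (@nsq_le0 _ _ ip); rewrite -oppr_ge0 -ripNl -[- z]add0r.
      by rewrite /rip (sa_sym saH Hg Hz) ip0r.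
    move: Hg; rewrite z0 subrr => Hg; apply: (@nsq_le0 _ _ ip).
    by rewrite /nsq /rip orth.
  apply/mp_inverseP; split=> [|z _]; last exact: ip0l.
  by exists 0; rewrite ?subrr; exact: sa0 saH.
apply/seteqP; split=> [[f g] /mp_inverseP [[z Hz Hg] orth] p q|[p q] adj] /=.
  move=> /mp_inverseP [[z' Hz' Hq] orth'].
  have := sa_sym saH Hq Hg.
  by rewrite !ipE (ip_eq0C (orth _ Hz')) (orth' _ Hz) !subr0.
have mpz z : H (z, 0) -> mp H (z, 0).
  move=> Hz; apply/mp_inverseP; split=> [|z' _]; last exact: ip0l.
  by exists z; rewrite ?subrr //; exact: sa0 saH.
have orthq z : H (z, 0) -> ip q z = 0.
  by move=> /mpz /adj /=; rewrite ip0l => /esym /ip_eq0C.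
have [z [Hz orthz]] := kernel_decomposition p.
apply/mp_inverseP; split=> //; exists z => //.
apply: (sa_adj saH) => w k Hwk.
have [z' [Hz' orthz']] := kernel_decomposition w.
have : mp H (k, w - z').
  apply/mp_inverseP; split=> //; exists 0; first exact: sa0 saH.
  by have := saB saH Hwk Hz'; rewrite !subr0.
move=> /adj /= <-; transitivity (ip (w - z') (p - z)).
  by rewrite [RHS]ipDr ipNr (orthz' _ Hz) subr0.
by rewrite ipDl ipNl (ip_eq0C (orthz _ Hz')) subr0.
Qed.

Lemma mp_inverse_ker : rel_ker (mp H) = rel_ker H.
Proof.
apply/seteqP; split=> f /=; rewrite /rel_ker /=.
  move=> /mp_inverseP [[z Hz H0] _]; have /eqP := sa_fun saH H0 (sa0 saH).
  by rewrite subr_eq0 => /eqP ->.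
move=> Hf; apply/mp_inverseP; split=> [|z _]; last exact: ip0l.
by exists f => //; rewrite subrr; exact: sa0 saH.
Qed.

Lemma mp_inverse_reduces Q : reduces ip Q H -> reduces ip Q (mp H).
Proof.
case=> [[linQ QQ symQ] QH]; split=> // f g /mp_inverseP [[z Hz Hg] orth].
have Qz z' : H (z', 0) -> H (Q z', 0) by move/QH; rewrite (lin0 linQ).
apply/mp_inverseP; split=> [|z' /Qz Hz']; last by rewrite symQ orth.
by exists (Q z); [exact: Qz|rewrite -(linB linQ); exact: QH].
Qed.

(** The form of H^+ at f is the form of H at g = H^+ f; this transfers signs between the two. *)
Lemma mp_inverse_form f g : mp H (f, g) ->
  exists2 z, H (z, 0) & H (g, f - z) /\ rip g f = rip (f - z) g.
Proof.
move=> /mp_inverseP [[z Hz Hg] orth]; exists z => //; split=> //.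
by rewrite [RHS]ripC ripDr ripNr (_ : rip g z = 0) ?subr0 // /rip orth.
Qed.

Lemma mp_inverse_fix Q f g : reduces ip Q (mp H) -> mp H (f, g) ->
  (Q f = f -> Q g = g) /\ (Q f = 0 -> Q g = 0).
Proof.
case=> _ QH Hfg; have sa := mp_inverse_selfadjoint.
split=> Qf; have := QH _ _ Hfg; rewrite Qf => h; first exact: (sa_fun sa h Hfg).
exact: (sa_fun sa h (sa0 sa)).
Qed.

Lemma mp_inverse_neg_split Q : neg_split ip H 0 Q -> neg_split ip (mp H) 0 Q.
Proof.
case=> /mp_inverse_reduces rQ neg pos; split=> // f g mpfg Qf => [f0|].
  have [Qg _] := mp_inverse_fix rQ mpfg.
  have [z Hz [Hg formE]] := mp_inverse_form mpfg; rewrite scale0r subr0 formE.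
  have [g0|g0] := eqVneq g 0; last first.
    by have := neg _ _ Hg (Qg Qf) g0; rewrite scale0r subr0.
  (* If g = 0, then f = z is a nonzero kernel vector in the range of Q, where the form of H is
     strictly negative. *)
  rewrite g0 in Hg; have /eqP := sa_fun saH Hg (sa0 saH).
  rewrite subr_eq0 => /eqP fz; move: Hz; rewrite -fz => /neg /(_ Qf f0).
  by rewrite scale0r subr0 rip0l ltxx.
have [_ Qg] := mp_inverse_fix rQ mpfg.
have [z _ [Hg formE]] := mp_inverse_form mpfg; rewrite scale0r subr0 formE.
by have := pos _ _ Hg (Qg Qf); rewrite scale0r subr0.
Qed.

Lemma mp_inverse_pos_split Q : pos_split ip H 0 Q -> pos_split ip (mp H) 0 Q.
Proof.
case=> /mp_inverse_reduces rQ pos neg; split=> // f g mpfg Qf => [f0|].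
  have [Qg _] := mp_inverse_fix rQ mpfg.
  have [z Hz [Hg formE]] := mp_inverse_form mpfg; rewrite scale0r subr0 formE.
  have [g0|g0] := eqVneq g 0; last first.
    by have := pos _ _ Hg (Qg Qf) g0; rewrite scale0r subr0.
  rewrite g0 in Hg; have /eqP := sa_fun saH Hg (sa0 saH).
  rewrite subr_eq0 => /eqP fz; move: Hz; rewrite -fz => /pos /(_ Qf f0).
  by rewrite scale0r subr0 rip0l ltxx.
have [_ Qg] := mp_inverse_fix rQ mpfg.
have [z _ [Hg formE]] := mp_inverse_form mpfg; rewrite scale0r subr0 formE.
by have := neg _ _ Hg (Qg Qf); rewrite scale0r subr0.
Qed.

(** * The spectral gap below 0 and its effect on the inverse *)

Section Gap.
Context (Q : V -> V) (spQ : neg_split ip H 0 Q).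
Context (finQ : (subspace_dim (range Q) < +oo)%E).

(** On the finite-dimensional range of Q, strict negativity of the form of A is uniform, and
    coercivity of H - x carries the bound over to H. *)
Lemma negative_gap (m : R) : lower_bounds ip H m ->
  exists2 e, 0 < e & forall g k, H (g, k) -> Q g = g -> rip k g <= - e * nsq g.
Proof.
move=> lbm; have [x xm x0] : exists2 x, x < m & x < 0.
  have [m0|m0] := ltP m 0; first by exists (m - 1); lra.
  by exists (- 1); lra.
have [[linQ QQ symQ] QH] := neg_reduces spQ.
have [neg _] := neg_split_quot ip_norm saH lbm xm x0 spQ.
have hA := shift_quot_hermitian ip_norm saH 0 lbm xm.
have [n [b [_ spanb _]]] := finite_basis (range_subspace linQ) finQ.
have [_ [d d0 coer]] := negative_span (b := b) hA ltac:(by rewrite spanb).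
have m0 : 0 < (m - x) ^+ 2 by rewrite exprn_gt0 // subr_gt0.
have x0' : 0 < - x by rewrite oppr_gt0.
(* For h = (H - x) g and k = H g: (k, k - x g) <= - d |h|^2 and |h|^2 >= (m - x)^2 |g|^2. Discard
   |k|^2 and divide by - x. *)
exists (d * (m - x) ^+ 2 / - x) => [|g k Hgk Qg].
  by rewrite divr_gt0 // mulr_gt0.
have Qk : Q k = k by have := QH _ _ Hgk; rewrite Qg => h; exact: (sa_fun saH h Hgk).
set h := k - x%:C *: g.
have Rh : g = resolvent H x h.
  by apply: (resolvent_unique ip_norm saH lbm) => //; rewrite subrK.
have Ah : shift_quot H x 0 h = k.
  by rewrite /shift_quot -Rh sub0r rmorphN scaleNr opprK subrK.
have : rip (shift_quot H x 0 h) h <= - d * nsq h.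
  apply: coer; rewrite spanb; exists h => //.
  by rewrite /h (linB linQ) (linZ linQ) Qk Qg.
have := sa_coercive saH lbm xm Hgk; rewrite -/h => /(ler_wpM2l (ltW d0)).
rewrite Ah {2}/h !ripE => le1 le2; rewrite -(ler_pM2l x0').
have -> : - x * (- (d * (m - x) ^+ 2 / - x) * nsq g) = - (d * ((m - x) ^+ 2 * nsq g)).
  by field; rewrite lt_eqF.
have := nsq_ge0 ip k; rewrite /nsq; lra.
Qed.

Context (e : R) (e0 : 0 < e).
Context (gap : forall g k, H (g, k) -> Q g = g -> rip k g <= - e * nsq g).

Lemma gap_neg_split y : - e < y -> y <= 0 -> neg_split ip H y Q.
Proof.
move=> ey y0; have [rQ _ pos] := spQ; split=> // g k Hgk Qg => [g0|].
  have := gap Hgk Qg; have : 0 < (e + y) * nsq g.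
    by rewrite mulr_gt0 ?nsq_gt0 // -ltrBlDl sub0r.
  by rewrite !ripE /nsq; lra.
have := pos _ _ Hgk Qg; have : 0 <= - y * nsq g by rewrite mulr_ge0 ?nsq_ge0 ?oppr_ge0.
by rewrite !ripE /nsq; lra.
Qed.

(** Only the Q-parts v of H g and n of g can contribute negatively; e |n|^2 <= - (v, n) and
    Cauchy-Schwarz give - (v, n) <= |v|^2 / e. *)
Lemma gap_mp_inverse_lower_bound : lower_bounds ip (mp H) (- e^-1).
Proof.
apply/(sa_lower_bound mp_inverse_selfadjoint) => f g /mp_inverse_form.
case=> z Hz [Hg ->]; have [[[linQ QQ symQ] QH] neg pos] := spQ.
set w := f - z; have Hgw : H (g, w) by [].
have fw : nsq w <= nsq f.
  have wz : rip w z = 0 by rewrite /rip (sa_sym saH Hgw Hz) ip0r.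
  have -> : f = w + z by rewrite subrK.
  by have := nsq_ge0 ip z; clearbody w; rewrite /nsq !ripE (ripC ip z) wz; lra.
clearbody w; have QHg := QH _ _ Hgw; set n := Q g in QHg *; set v := Q w in QHg *.
have Qn : Q n = n := QQ g; have Qv : Q v = v := QQ w.
have vw : nsq v <= nsq w.
  have : rip w v = nsq v by rewrite /nsq /rip /v symQ QQ.
  by clearbody v; have := nsq_ge0 ip (w - v); rewrite /nsq !ripE (ripC ip v w); lra.
have wg : rip v n <= rip w g.
  have := pos _ _ (saB saH Hgw QHg); rewrite (linB linQ) Qn subrr => /(_ erefl).
  have vg : rip v g = rip v n by rewrite /rip -Qv symQ Qv.
  have wn : rip w n = rip v n by rewrite /rip -Qn -symQ Qn.
  by clearbody v n; rewrite scale0r subr0 !ripE vg wn; lra.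
have gapn := gap QHg Qn; have cs := cauchy_schwarz ip v n.
rewrite mulNr -lerN2 opprK; apply: (@le_trans _ _ (- rip v n)); first by rewrite lerN2.
apply: le_trans (_ : e^-1 * nsq v <= _); last first.
  by rewrite ler_wpM2l ?invr_ge0 ?(ltW e0) // (le_trans vw).
rewrite -(ler_pM2l e0) mulrA mulfV ?gt_eqF // mul1r.
have [a0|a0] := leP 0 (rip v n).
  apply: (@le_trans _ _ 0); last exact: nsq_ge0.
  by rewrite mulrN oppr_le0 mulr_ge0 // ltW.
have a0' : 0 < - rip v n by rewrite oppr_gt0.
rewrite -(ler_pM2r a0').
apply: (@le_trans _ _ (e * (nsq v * nsq n))); first by rewrite -mulrA ler_pM2l //; lra.
have : nsq v * (e * nsq n) <= nsq v * - rip v n by rewrite ler_wpM2l ?nsq_ge0 //; lra.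
lra.
Qed.

End Gap.

(** Solved through H^+: with u the resolvent of H^+ at 1/y applied to f and w = f + u / y = H^+ u,
    the solution is v = - w / y. *)
Lemma shift_solution (m' y : R) f z : y != 0 ->
    lower_bounds ip (mp H) m' -> y^-1 < m' ->
    H (z, 0) -> (forall z', H (z', 0) -> ip (f - z) z' = 0) ->
  exists v, H (v, (f - z) + y%:C *: v).
Proof.
move=> y0 lb' ym' Hz orth.
have := resolventP ip_norm mp_inverse_selfadjoint lb' ym' f.
set u := resolvent _ _ _; have [w wE] : {w | w = f + (y^-1)%:C *: u} by exists (f + (y^-1)%:C *: u).
rewrite -wE => /mp_inverseP [[z' Hz' Hw] orthw].
have uE : u = y%:C *: (w - f).
  by rewrite wE addrAC subrr add0r scalerA -rmorphM divff // scale1r.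
have {}Hz' : H (z' + y%:C *: z, 0).
  by have := saD saH Hz' (saZ saH y%:C Hz); rewrite scaler0 addr0.
have [d dE] : {d | d = z' + y%:C *: z} by exists (z' + y%:C *: z).
rewrite -dE in Hz'.
(* z' is the kernel component of u = y (w - f), and that component is - y z because w is orthogonal
   to the kernel. *)
have d0 : d = 0.
  apply: (@nsq_le0 _ _ ip); rewrite /nsq /rip {1}dE ipDl ipZl.
  have zd : ip z d = ip f d.
    by apply/esym/eqP; rewrite -subr_eq0 -ipNl -ipDl orth.
  have -> : ip z' d = ip u d.
    apply/esym/eqP; rewrite -subr_eq0 -ipNl -ipDl.
    by rewrite (sa_sym saH Hw Hz') ip0r.
  by rewrite uE ipZl ipDl ipNl orthw // zd sub0r mulrN addNr.
exists (- (y^-1)%:C *: w); have := saZ saH (- (y^-1)%:C) Hw; congr (H (_, _)).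
have -> : z' = - (y%:C *: z) by apply/eqP; rewrite -addr_eq0 -dE d0.
have yV : - (y^-1)%:C * y%:C = -1 by rewrite mulNr -rmorphM mulVf.
rewrite uE opprK -scalerDr !scalerA [y%:C * _]mulrC yV !scaleN1r.
by rewrite opprD opprB addrAC.
Qed.

(* (H^+ - 1/y)^-1 f = - y f - y^2 (H - y)^-1 c, where c is the component of f
   orthogonal to ker H. *)
Lemma mp_inverse_resolvent (m' y : R) f z v : y != 0 ->
    lower_bounds ip (mp H) m' -> y^-1 < m' ->
    H (z, 0) -> (forall z', H (z', 0) -> ip (f - z) z' = 0) ->
    H (v, (f - z) + y%:C *: v) ->
  rip (resolvent (mp H) y^-1 f) f = - y * nsq f - y ^+ 2 * rip v (f - z).
Proof.
move=> y0 lb' ym' Hz orth Hv.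
have orthv z' : H (z', 0) -> ip v z' = 0.
  move=> Hz'; have := sa_sym saH Hv Hz'; rewrite ip0r ipDl orth // add0r ipZl.
  move=> /eqP; rewrite mulf_eq0 => /orP[|/eqP //].
  by rewrite eq_complex /= eqxx andbT (negPf y0).
set u := - (y%:C *: f) - (y ^+ 2)%:C *: v.
have uE : f + (y^-1)%:C *: u = - (y%:C *: v).
  rewrite /u scalerBr scalerN !scalerA -!rmorphM mulVf // scale1r addrA subrr add0r.
  by rewrite expr2 mulrA mulVf // mul1r.
have <- : u = resolvent (mp H) y^-1 f.
  apply: (resolvent_unique ip_norm mp_inverse_selfadjoint lb') => //; rewrite uE.
  apply/mp_inverseP; split=> [|z' Hz']; last by rewrite !ipE orthv // mulr0 oppr0.
  exists (- y%:C *: z); first by have := saZ saH (- y%:C) Hz; rewrite scaler0.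
  have := saZ saH (- y%:C) Hv; rewrite scaleNr; congr (H (_, _)).
  rewrite /u scalerDr scalerBr scalerA !scaleNr mulNr -rmorphM expr2 opprK.
  by rewrite addrAC scaleNr.
have vf : rip v f = rip v (f - z).
  by rewrite [RHS]ripDr ripNr (_ : rip v z = 0) ?subr0 // /rip orthv.
by rewrite -vf /u !ripE /nsq; ring.
Qed.

End MoorePenrose.

(** * Spectral measures *)

Section RawIntegral.
Context d (T : measurableType d) (R : realType).
Local Open Scope ereal_scope.
Import HBNNSimple.

(* Unlike eq_measure_integral, this applies to scalar_measure, which is not a
   measure since its values at non-measurable sets are arbitrary. *)
Lemma eq_set_function_integral (m1 m2 : set T -> \bar R) (f : T -> \bar R) :
    (forall A, measurable A -> m1 A = m2 A) ->
  \int[m1]_t f t = \int[m2]_t f t.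
Proof.
move=> m12.
have sint (h : {nnsfun T >-> R}) : sintegral m1 h = sintegral m2 h.
  by apply: eq_fsbigr => r _; rewrite m12.
rewrite /integral; congr (ereal_sup _ - ereal_sup _);
  by apply/seteqP; split=> _ [h hf <-]; exists h.
Qed.

End RawIntegral.

Section IntegralSigns.
Context d (T : measurableType d) (R : realType) (M : {measure set T -> \bar R}).
Local Open Scope ereal_scope.

Lemma ge0_integral_eq0 (f : T -> \bar R) : measurable_fun [set: T] f ->
  (forall t, 0 <= f t) ->
  \int[M]_t f t = 0 <-> M [set t | f t != 0] = 0.
Proof.
move=> mf f0.
have -> : \int[M]_t f t = \int[M]_t `|f t|.
  by apply: eq_integral => t _; rewrite gee0_abs.
have mN : measurable [set t | f t != 0].
  by rewrite -[X in measurable X]setTI; exact: emeasurable_neq.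
have setE : ~` [set t | setT t -> f t = cst 0 t] = [set t | f t != 0].
  apply/seteqP; split=> t /=; first by move=> ft0; apply/eqP => ft; exact: ft0.
  by move=> /eqP ft0 /(_ I).
rewrite ae_eq_integral_abs // /ae_eq; split=> [|MN0].
  by move=> /negligibleP; rewrite setE; apply.
by apply/negligibleP; rewrite setE.
Qed.

End IntegralSigns.

(** * Sign of the mean of a measure on the line *)

Section MeanSign.
Context (R : realType) (M : {measure set R -> \bar R}).
Local Open Scope ereal_scope.

Let mid : measurable_fun [set: R] (@EFin R).
Proof. exact/measurable_EFinP/measurable_id. Qed.

Let pos_part_neq0 : [set t : R | (@EFin R)^\+ t != 0] = `]0%R, +oo[%classic.
Proof.
apply/seteqP; split=> t; rewrite /= funeposE in_itv /= andbT -EFin_max eqe.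
  by case: ltP => //; rewrite eqxx.
by move=> t0; rewrite (max_idPl (ltW t0)) gt_eqF.
Qed.

Let neg_part_neq0 : [set t : R | (@EFin R)^\- t != 0] = `]-oo, 0%R[%classic.
Proof.
apply/seteqP; split=> t; rewrite /= funenegE in_itv /= -EFin_max eqe.
  by rewrite -oppr_gt0; case: ltP => //; rewrite eqxx.
by move=> t0; rewrite (max_idPl _) ?oppr_ge0 ?(ltW t0) // oppr_eq0 lt_eqF.
Qed.

Let int_pos_part : M `]0%R, +oo[%classic = 0 -> \int[M]_t (@EFin R)^\+ t = 0.
Proof.
move=> M0; apply/ge0_integral_eq0; rewrite ?pos_part_neq0 //.
exact: measurable_funepos.
Qed.

Let int_neg_part : M `]-oo, 0%R[%classic = 0 -> \int[M]_t (@EFin R)^\- t = 0.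
Proof.
move=> M0; apply/ge0_integral_eq0; rewrite ?neg_part_neq0 //.
exact: measurable_funeneg.
Qed.

Lemma mean_le0 : M `]0%R, +oo[%classic = 0 ->
  (fine (\int[M]_t t%:E) <= 0)%R.
Proof.
move=> /int_pos_part M0; rewrite integralE M0 sub0e fineN oppr_le0.
by rewrite fine_ge0 // integral_ge0.
Qed.

Lemma mean_ge0 : M `]-oo, 0%R[%classic = 0 ->
  (0 <= fine (\int[M]_t t%:E))%R.
Proof.
move=> /int_neg_part M0; rewrite integralE M0 sube0.
by rewrite fine_ge0 // integral_ge0.
Qed.

Context (finM : M setT < +oo) (fin2 : \int[M]_t (t ^+ 2)%:E < +oo).

Let dominated (f : R -> \bar R) : measurable_fun [set: R] f ->
  (forall t, 0 <= f t) -> (forall t, f t <= 1 + (t ^+ 2)%:E) ->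
  \int[M]_t f t < +oo.
Proof.
move=> mf f0 fle.
have msq : measurable_fun [set: R] (fun t : R => (t ^+ 2)%:E).
  exact/measurable_EFinP/measurable_funX.
have sq0 (t : R) : 0 <= (t ^+ 2)%:E by rewrite lee_fin sqr_ge0.
apply: (@le_lt_trans _ _ (\int[M]_t (1 + (t ^+ 2)%:E))).
  by apply: ge0_le_integral => //; exact: emeasurable_funD.
rewrite ge0_integralD // lte_add_pinfty // integral_cst // mul1e.
exact: finM.
Qed.

(** [fine] sends +oo to 0, so strictness requires a finite integral; it comes from the bound 1 +
    t^2. *)
Lemma mean_lt0 : M `]0%R, +oo[%classic = 0 -> M `]-oo, 0%R[%classic != 0 ->
  (fine (\int[M]_t t%:E) < 0)%R.
Proof.
move=> /int_pos_part M0 Mn; rewrite integralE M0 sub0e fineN oppr_lt0.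
apply: fine_gt0; rewrite lt_def integral_ge0 // andbT; apply/andP; split.
  apply: contra_neq Mn => /ge0_integral_eq0; rewrite neg_part_neq0; apply => //.
  exact: measurable_funeneg.
apply: dominated => // [|t]; first exact: measurable_funeneg.
rewrite funenegE -EFinN -EFin_max -EFinD lee_fin ge_max.
by have := sqr_ge0 (t + 1); have := sqr_ge0 t; lra.
Qed.

Lemma mean_gt0 : M `]-oo, 0%R[%classic = 0 -> M `]0%R, +oo[%classic != 0 ->
  (0 < fine (\int[M]_t t%:E))%R.
Proof.
move=> /int_neg_part M0 Mp; rewrite integralE M0 sube0.
apply: fine_gt0; rewrite lt_def integral_ge0 // andbT; apply/andP; split.
  apply: contra_neq Mp => /ge0_integral_eq0; rewrite pos_part_neq0; apply => //.
  exact: measurable_funepos.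
apply: dominated => // [|t]; first exact: measurable_funepos.
rewrite funeposE -EFin_max -EFinD lee_fin ge_max.
by have := sqr_ge0 (t - 1); have := sqr_ge0 t; lra.
Qed.

End MeanSign.

(** * Projection-valued measures *)

Section SpectralMeasure.
Context (R : realType) (V : completeNormedModType R[i]).
Context (ip : {dot V for Num.conj}) (ip_norm : induces_norm ip).
Local Notation rip := (rip ip).
Local Notation nsq := (nsq ip).
Context (E : set R -> V -> V) (pvm : projection_valued_measure ip E).
Implicit Types (A B : set R).

Let proj B : measurable B -> orthogonal_projection ip (E B).
Proof. by case: pvm => + _ _; apply. Qed.

Lemma pvm_sigma_additive (F : nat -> set R) h :
  (forall n, measurable (F n)) -> trivIset setT F ->
  (fun n => \sum_(i < n) E (F i) h) @ \oo --> E (\bigcup_n F n) h.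
Proof. by case: pvm => _ _ + mF tF => /(_ F mF tF h). Qed.

Lemma pvm_set0 h : E set0 h = 0.
Proof.
have t0 : trivIset setT (fun _ : nat => set0 : set R).
  by apply/trivIsetP => i j _ _ _; rewrite setI0.
have := pvm_sigma_additive (h := h) (fun=> measurable0) t0; rewrite bigcup0 // => cvgc.
have := cvgc; rewrite -cvg_shiftS => cvgS.
have cst_cvg : (fun n => E set0 h) @ \oo --> (0 : V).
  (* A term of a convergent series is a difference of consecutive partial sums, so these constant
     terms tend to 0. *)
  have -> : (fun=> E set0 h) =
      (fun n => \sum_(i < n.+1) E set0 h - \sum_(i < n) E set0 h).
    by apply/funext => n; rewrite big_ord_recr addrAC subrr add0r.
  by rewrite -[X in _ --> X](subrr (E set0 h)); exact: cvgB cvgS cvgc.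
exact: (cvg_unique (@norm_hausdorff _ _) (cvg_cst _) cst_cvg).
Qed.

Lemma pvmU A B h : measurable A -> measurable B -> A `&` B = set0 ->
  E (A `|` B) h = E A h + E B h.
Proof.
move=> mA mB AB; have t2 : trivIset setT (bigcup2 A B) by rewrite -trivIset_bigcup2.
have m2 n : measurable (bigcup2 A B n) by case: n => [|[|n]] /=.
have := pvm_sigma_additive (h := h) m2 t2; rewrite bigcup2E.
have : (fun n => \sum_(i < n) E (bigcup2 A B i) h) @ \oo --> E A h + E B h.
  apply: cvg_near_cst; exists 2%N => // -[|[|n]] //= _.
  rewrite !big_ord_recl /= big1 ?addr0 //= => i _; exact: pvm_set0.
by move=> c1 c2; exact: (cvg_unique (@norm_hausdorff _ _) c2 c1).
Qed.

Lemma proj_form P h : orthogonal_projection ip P -> rip (P h) h = nsq (P h).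
Proof. by case=> _ PP symP; rewrite /nsq /rip [in RHS]symP PP symP. Qed.

Lemma proj_nsq_le P h : orthogonal_projection ip P -> nsq (P h) <= nsq h.
Proof.
move=> oP; have := nsq_ge0 ip (h - P h).
have := proj_form h oP; move: (P h) => v; rewrite /nsq !ripE (ripC ip h v); lra.
Qed.

(** E(A u B) is a contraction; at E(B) h this reads |E(A) E(B) h|^2 + |E(B) h|^2 <= |E(B) h|^2. *)
Lemma pvm_disjoint A B h : measurable A -> measurable B -> A `&` B = set0 ->
  E A (E B h) = 0.
Proof.
move=> mA mB AB; apply: (@nsq_le0 _ _ ip).
have [_ BB _] := proj mB; have oAB := proj (measurableU _ _ mA mB).
have := proj_nsq_le (E B h) oAB; rewrite -(proj_form _ oAB).
rewrite pvmU // ripDl (proj_form _ (proj mA)) (proj_form _ (proj mB)) BB; lra.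
Qed.

Lemma pvm_split B h : measurable B -> h = E B h + E (~` B) h.
Proof.
move=> mB; rewrite -pvmU //; last by rewrite setICr.
  by rewrite setUv; case: pvm => _ ->.
exact: measurableC.
Qed.

Lemma pvm_mul A B h : measurable A -> measurable B ->
  E A (E B h) = E (A `&` B) h.
Proof.
move=> mA mB; have mC := measurableC mB.
have mAB := measurableI _ _ mA mB; have mAC := measurableI _ _ mA mC.
have [linAB _ _] := proj mAB.
rewrite -{1}[A](setIT A) -(setUv B) setIUr pvmU //; last first.
  by rewrite setIACA setICr setI0.
rewrite (pvm_disjoint _ mAC mB) ?addr0; last by rewrite -setIA setICl setI0.
rewrite [in RHS](pvm_split h mB) (linD linAB) [X in _ = _ + X](pvm_disjoint _ mAB mC).
  by rewrite addr0.
by rewrite -setIA setICr setI0.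
Qed.

Lemma pvm_comm A B h : measurable A -> measurable B ->
  E A (E B h) = E B (E A h).
Proof. by move=> mA mB; rewrite !pvm_mul // setIC. Qed.

(** Agrees with [scalar_measure] on Borel sets and is nonnegative on all sets, so it can be packed
    as a measure. *)
Definition mass h B : \bar R := (nsq (E B h))%:E.

Lemma scalar_measureE h B : measurable B -> scalar_measure ip E h B = mass h B.
Proof. by move=> mB; rewrite /mass -proj_form //; exact: proj. Qed.

Lemma mass_sigma_additive h : semi_sigma_additive (mass h).
Proof.
move=> F mF tF mU.
have partial n : (\sum_(0 <= i < n) mass h (F i))%E =
    (rip (\sum_(i < n) E (F i) h) h)%:E.
  rewrite big_mkord; elim: n => [|n IHn]; first by rewrite !big_ord0 rip0l.
  rewrite !big_ord_recr /= IHn ripDl EFinD; congr (_ + _)%E.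
  by rewrite /mass proj_form //; exact: proj.
rewrite (funext partial) /mass -proj_form; last exact: proj.
apply: cvg_EFin; first by near=> n.
have := pvm_sigma_additive (h := h) mF tF; move: (E (\bigcup_n F n) h) => v.
move=> /cvgrPdist_lt cvgv; apply/cvgrPdist_lt => e e0.
have n1 : 0 < nsq h + 1 by have := nsq_ge0 ip h; lra.
have d0 : 0 < e ^+ 2 / (nsq h + 1) by rewrite divr_gt0 // exprn_gt0.
have s0 : 0 < Num.sqrt (e ^+ 2 / (nsq h + 1)) by rewrite sqrtr_gt0.
have := cvgv (Num.sqrt (e ^+ 2 / (nsq h + 1)))%:C; rewrite ltcR => /(_ s0).
apply: filterS => n /=.
rewrite (normr_lt ip_norm) // sqr_sqrtr ?ltW // ltr_pdivlMr // => lt_n.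
rewrite -ripNl -ripDl -ltr_sqr ?nnegrE ?normr_ge0 ?ltW // real_normK ?num_real //.
apply: le_lt_trans (cauchy_schwarz _ _ _) (le_lt_trans _ lt_n).
by rewrite ler_wpM2l ?nsq_ge0 // lerDl.
Unshelve. all: by end_near.
Qed.

Lemma mass_measure h : exists M : {measure set R -> \bar R}, forall B, M B = mass h B.
Proof.
have m0 : mass h set0 = 0%E by rewrite /mass pvm_set0 nsq0.
have mge0 B : (0 <= mass h B)%E by rewrite lee_fin nsq_ge0.
pose mix := isMeasure.Build _ R R (mass h) m0 mge0 (@mass_sigma_additive h).
pose M : {measure set R -> \bar R} := HB.pack (mass h) mix.
by exists M.
Qed.

(** * Signs of the form on the spectral subspaces of an operator *)

Section Operator.
Context (H : set (V * V)) (saH : selfadjoint_operator ip H).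
Context (spH : spectral_measure ip E H).

Let mass_integral h (f : R -> \bar R) :
  (\int[scalar_measure ip E h]_t f t = \int[mass h]_t f t)%E.
Proof. by apply: eq_set_function_integral => B; exact: scalar_measureE. Qed.

Let domP g : (exists k, H (g, k)) <-> (\int[mass g]_t (t ^+ 2)%:E < +oo)%E.
Proof. by rewrite -mass_integral; case: spH. Qed.

Let formE g k : H (g, k) -> rip k g = fine (\int[mass g]_t t%:E)%E.
Proof. by rewrite -mass_integral; case: spH => _ _ + Hgk; rewrite /rip => ->. Qed.

(** E(B) commutes with every E(A), so it decreases the measure of g and with it the second moment
    that describes the domain. *)
Let spectral_dom B g k : measurable B -> H (g, k) -> exists k', H (E B g, k').
Proof.
move=> mB Hgk; apply/domP.
have : exists k, H (g, k) by exists k.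
move=> /domP; apply: le_lt_trans.
have [[M ME] [M' M'E]] := (mass_measure g, mass_measure (E B g)).
have -> : mass g = M by apply/funext => A; rewrite ME.
have -> : mass (E B g) = M' by apply/funext => A; rewrite M'E.
apply: ge0_le_measure_integral => //.
- move=> A mA; apply: le_trans (_ : mass g A <= _)%E; last by rewrite -ME.
  by rewrite M'E lee_fin pvm_comm // proj_nsq_le //; exact: proj.
- by move=> t; rewrite lee_fin sqr_ge0.
- exact/measurable_EFinP/measurable_funX.
Qed.

(* The measures of g + c g' and g - c g' coincide, hence so do the values of
   the form of H at these vectors. *)
Let spectral_orth B g k g' k' : measurable B -> H (g, k) -> H (g', k') ->
  E B g = g -> E B g' = 0 -> ip k g' = 0.
Proof.
move=> mB Hgk Hgk' Eg Eg'; apply: ip_eq0C; apply: ip_eq0 => c.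
have mass_eq C : measurable C -> mass (g + c *: g') C = mass (g - c *: g') C.
  move=> mC; have [linC _ _] := proj mC; have [_ _ symB] := proj mB.
  rewrite /mass (linB linC) (linD linC) (linZ linC); congr (_%:E).
  have : rip (c *: E C g') (E C g) = 0.
    rewrite /rip -Eg pvm_comm // ipZl -symB pvm_comm // Eg'.
    by have [linC' _ _] := proj mC; rewrite (lin0 linC') ip0l mulr0.
  by rewrite /nsq !ripE (ripC ip (E C g)) => ->; ring.
have formC := saZ saH c Hgk'.
have := formE (saD saH Hgk formC); have := formE (saB saH Hgk formC).
rewrite (eq_set_function_integral _ mass_eq) => <-.
have : rip (c *: k') g = rip (c *: g') k.
  by rewrite /rip (sa_sym saH formC Hgk).
rewrite !ripE !(ripC ip k (c *: g')); lra.
Qed.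

(** [spectral_orth] removes the cross terms between E(B) and its complement, which puts (E(B) g,
    E(B) k) into the adjoint of H. *)
Lemma spectral_reduces B : measurable B -> reduces ip (E B) H.
Proof.
move=> mB; have oB := proj mB; split=> // g k Hgk.
have [linB' BB symB] := oB.
apply: (sa_adj saH) => p q Hpq.
have [a Ha] := spectral_dom mB Hgk; have [b Hb] := spectral_dom mB Hpq.
have compl h : E B (h - E B h) = 0 by rewrite (linB linB') BB subrr.
have o1 : ip a (p - E B p) = 0.
  exact: (spectral_orth mB Ha (saB saH Hpq Hb) (BB g) (compl p)).
have o2 : ip b (g - E B g) = 0.
  exact: (spectral_orth mB Hb (saB saH Hgk Ha) (BB p) (compl g)).
rewrite -[in RHS]symB -(sa_sym saH Hb Hgk) -[g in RHS](subrK (E B g)) ipDr o2 add0r.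
have := sa_sym saH (saB saH Hpq Hb) Ha.
rewrite (ip_eq0C o1) ipDl ipNl => /eqP; rewrite subr_eq0 => /eqP ->.
by [].
Qed.

Let mass_setT g : mass g setT = (nsq g)%:E.
Proof. by rewrite /mass; case: pvm => _ ->. Qed.

Let mneg : measurable (`]-oo, 0%R[%classic : set R). Proof. exact: measurable_itv. Qed.
Let mpos : measurable (`]0%R, +oo[%classic : set R). Proof. exact: measurable_itv. Qed.
Let neg_pos : `]-oo, 0%R[%classic `&` `]0%R, +oo[%classic = set0 :> set R.
Proof.
apply/seteqP; split=> t //= []; rewrite !in_itv /= andbT => t0 /(lt_trans t0).
by rewrite ltxx.
Qed.

Let mass_gt0 B g : E B g = g -> g != 0 -> mass g B != 0%E.
Proof. by move=> Eg g0; rewrite /mass Eg eqe gt_eqF // nsq_gt0. Qed.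

Lemma spectral_neg_split : neg_split ip H 0 (E `]-oo, 0%R[%classic).
Proof.
split=> [|g k Hgk Eg g0|g k Hgk Eg]; first exact: spectral_reduces.
  rewrite scale0r subr0 (formE Hgk).
  have : (\int[mass g]_t (t ^+ 2)%:E < +oo)%E by apply/domP; exists k.
  have [M ME] := mass_measure g; have -> : mass g = M by apply/funext.
  move=> fin2; apply: mean_lt0 => //; rewrite ME ?mass_setT ?ltry ?mass_gt0 //.
  by rewrite /mass -Eg pvm_disjoint ?nsq0 // setIC.
rewrite scale0r subr0 (formE Hgk).
have [M ME] := mass_measure g; have -> : mass g = M by apply/funext.
by apply: mean_ge0; rewrite ME /mass Eg nsq0.
Qed.

Lemma spectral_pos_split : pos_split ip H 0 (E `]0%R, +oo[%classic).
Proof.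
split=> [|g k Hgk Eg g0|g k Hgk Eg]; first exact: spectral_reduces.
  rewrite scale0r subr0 (formE Hgk).
  have : (\int[mass g]_t (t ^+ 2)%:E < +oo)%E by apply/domP; exists k.
  have [M ME] := mass_measure g; have -> : mass g = M by apply/funext.
  move=> fin2; apply: mean_gt0 => //; rewrite ME ?mass_setT ?ltry ?mass_gt0 //.
  by rewrite /mass -Eg pvm_disjoint ?nsq0.
rewrite scale0r subr0 (formE Hgk).
have [M ME] := mass_measure g; have -> : mass g = M by apply/funext.
by apply: mean_le0; rewrite ME /mass Eg nsq0.
Qed.

End Operator.
End SpectralMeasure.

(** * Antitonicity of the Moore-Penrose inverse *)

Section InverseOrder.
Context (R : realType) (V : completeNormedModType R[i]).
Context (ip : {dot V for Num.conj}) (ip_norm : induces_norm ip).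
Local Notation rip := (rip ip).
Local Notation mp H := (mp_inverse ip H).

Section Pair.
Context (H1 H2 : set (V * V)).
Context (sa1 : selfadjoint_operator ip H1) (sa2 : selfadjoint_operator ip H2).
Context (le12 : op_le ip H1 H2).

(** The order provides a single x; comparisons at a shift y need x < y. *)
Lemma op_le_below c : exists x m1 m2, [/\ x < c, lower_bounds ip H1 m1 /\ x < m1,
  lower_bounds ip H2 m2 /\ x < m2 & resolvent_le ip H1 H2 x].
Proof.
have [x [m1 [m2 [lb1 xm1 lb2 xm2 le_x]]]] := (op_leP ip_norm sa1 sa2).1 le12.
pose x0 := Num.min x c - 1.
have x0x : x0 < x by rewrite ltrBlDr (@le_lt_trans _ _ x) ?ltrDl // ge_min lexx.
have x0c : x0 < c by rewrite ltrBlDr (@le_lt_trans _ _ c) ?ltrDl // ge_min lexx orbT.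
exists x0, m1, m2; split => //; try by split => //; exact: lt_trans x0x _.
exact: (resolvent_le_shift ip_norm sa1 sa2 lb1 lb2 xm1 xm2 le_x x0x).
Qed.

Context (N1 N2 : V -> V) (spN1 : neg_split ip H1 0 N1) (spN2 : neg_split ip H2 0 N2).

Lemma op_le_neg_dim : (subspace_dim (range N2) <= subspace_dim (range N1))%E.
Proof.
have [x [m1 [m2 [x0 [lb1 xm1] [lb2 xm2] le_x]]]] := op_le_below 0.
exact: (neg_dim_antitone ip_norm sa1 sa2 lb1 lb2 xm1 xm2 le_x x0 spN1 spN2).
Qed.

Lemma op_le_pos_dim P1 P2 : pos_split ip H1 0 P1 -> pos_split ip H2 0 P2 ->
  (subspace_dim (range P1) <= subspace_dim (range P2))%E.
Proof.
have [x [m1 [m2 [x0 [lb1 xm1] [lb2 xm2] le_x]]]] := op_le_below 0.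
exact: (pos_dim_monotone ip_norm sa1 sa2 lb1 lb2 xm1 xm2 le_x x0).
Qed.

Context (dim12 : (subspace_dim (range N1) <= subspace_dim (range N2) < +oo)%E).

Lemma op_le_kernel : rel_ker H2 `<=` rel_ker H1.
Proof.
have [x [m1 [m2 [x0 [lb1 xm1] [lb2 xm2] le_x]]]] := op_le_below 0.
move=> k Hk.
have := eigenvector_antitone ip_norm sa1 sa2 lb1 lb2 xm1 xm2 le_x x0 spN1 spN2 dim12 (k := k).
by rewrite scale0r; exact.
Qed.

Lemma op_le_mp_inverse : rel_ker H1 = rel_ker H2 -> op_le ip (mp H2) (mp H1).
Proof.
move=> ker12; have /andP[dim_le fin2] := dim12.
have fin1 : (subspace_dim (range N1) < +oo)%E by exact: le_lt_trans dim_le fin2.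
have [x [m1 [m2 [x0 [lb1 xm1] [lb2 xm2] le_x]]]] := op_le_below 0.
have [e1 e10 gap1] := negative_gap ip_norm sa1 spN1 fin1 lb1.
have [e2 e20 gap2] := negative_gap ip_norm sa2 spN2 fin2 lb2.
have sa1' := mp_inverse_selfadjoint ip_norm sa1.
have sa2' := mp_inverse_selfadjoint ip_norm sa2.
have lb1' := gap_mp_inverse_lower_bound ip_norm sa1 spN1 e10 gap1.
have lb2' := gap_mp_inverse_lower_bound ip_norm sa2 spN2 e20 gap2.
(* Half of the negative number max (x, - e1, - e2) exceeds x and lies in both gaps. *)
have [y [y0 xy ye1 ye2]] : exists y, [/\ y < 0, x < y, - e1 < y & - e2 < y].
  pose z := Num.max x (Num.max (- e1) (- e2)).
  have z0 : z < 0 by rewrite !gt_max x0 !oppr_lt0 e10 e20.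
  have [xz z1 z2] : [/\ x <= z, - e1 <= z & - e2 <= z].
    by rewrite /z !le_max !lexx !orbT.
  by exists (z / 2); split; lra.
(* 1/y lies below the bound - 1/e_j of H_j^+, so the resolvents of both inverses are available
   there. *)
have inv_lt e : 0 < e -> - e < y -> y^-1 < - e^-1.
  move=> e0 ey; rewrite ltrNr -invrN ltf_pV2 ?posrE ?oppr_gt0 //.
  by rewrite ltrNl.
have y1 := inv_lt _ e10 ye1; have y2 := inv_lt _ e20 ye2.
have yn0 : y != 0 by rewrite lt_eqF.
have sp1 := gap_neg_split spN1 gap1 ye1 (ltW y0).
have sp2 := gap_neg_split spN2 gap2 ye2 (ltW y0).
apply/(op_leP ip_norm sa2' sa1'); exists y^-1, (- e2^-1), (- e1^-1); split => // f.
have [z [Hz orth]] := kernel_decomposition ip_norm sa1 f.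
have Hz2 : H2 (z, 0) by have : rel_ker H1 z by []; rewrite ker12.
have orth2 z' : H2 (z', 0) -> ip (f - z) z' = 0.
  by move=> Hz'; apply: orth; have : rel_ker H2 z' by []; rewrite -ker12.
have [v1 Hv1] := shift_solution ip_norm sa1 yn0 lb1' y1 Hz orth.
have [v2 Hv2] := shift_solution ip_norm sa2 yn0 lb2' y2 Hz2 orth2.
rewrite (mp_inverse_resolvent ip_norm sa1 yn0 lb1' y1 Hz orth Hv1).
rewrite (mp_inverse_resolvent ip_norm sa2 yn0 lb2' y2 Hz2 orth2 Hv2).
rewrite lerD2l lerN2 ler_wpM2l ?sqr_ge0 //.
exact: (inverse_shift_antitone ip_norm sa1 sa2 lb1 lb2 xm1 xm2 le_x xy sp1 sp2 dim12).
Qed.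

End Pair.
End InverseOrder.

Theorem theorem3p8 (R : realType) (V : completeNormedModType R[i])
    (ip : {dot V for Num.conj}) (ip_norm : induces_norm ip)
    (sepV : separable V)
    (H1 H2 : set (V * V))
    (sa1 : selfadjoint_operator ip H1) (sa2 : selfadjoint_operator ip H2)
    (bb1 : bounded_from_below ip H1) (bb2 : bounded_from_below ip H2)
    (E1 E2 : set R -> V -> V)
    (spE1 : spectral_measure ip E1 H1) (spE2 : spectral_measure ip E2 H2)
    (fin1 : (ineg (inertia E1 H1) + izero (inertia E1 H1) < +oo)%E)
    (le12 : op_le ip H1 H2) :
  op_le ip (mp_inverse ip H2) (mp_inverse ip H1) <->
  rel_ker H1 = rel_ker H2 /\ inertia E1 H1 = inertia E2 H2.
Proof.
have [pvm1 _ _] := spE1; have [pvm2 _ _] := spE2.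
have spN1 := spectral_neg_split ip_norm pvm1 sa1 spE1.
have spN2 := spectral_neg_split ip_norm pvm2 sa2 spE2.
have spP1 := spectral_pos_split ip_norm pvm1 sa1 spE1.
have spP2 := spectral_pos_split ip_norm pvm2 sa2 spE2.
have finN1 : (ineg (inertia E1 H1) < +oo)%E.
  by apply: le_lt_trans fin1; rewrite leeDl //; exact: subspace_dim_ge0.
have dim21 := op_le_neg_dim ip_norm sa1 sa2 le12 spN1 spN2.
have finN2 := le_lt_trans dim21 finN1.
split=> [le21|[ker12 [_ dim12 _ _]]]; last first.
  apply: (op_le_mp_inverse ip_norm sa1 sa2 le12 spN1 spN2) => //.
  by rewrite dim12 lexx -dim12.
have sa1' := mp_inverse_selfadjoint ip_norm sa1.
have sa2' := mp_inverse_selfadjoint ip_norm sa2.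
have spN1' := mp_inverse_neg_split ip_norm sa1 spN1.
have spN2' := mp_inverse_neg_split ip_norm sa2 spN2.
have spP1' := mp_inverse_pos_split ip_norm sa1 spP1.
have spP2' := mp_inverse_pos_split ip_norm sa2 spP2.
(* H_2^+ <= H_1^+ with the same projections yields the opposite inequalities. *)
have dim12 := op_le_neg_dim ip_norm sa2' sa1' le21 spN2' spN1'.
have pos12 := op_le_pos_dim ip_norm sa1 sa2 le12 spP1 spP2.
have pos21 := op_le_pos_dim ip_norm sa2' sa1' le21 spP2' spP1'.
have ker12 : rel_ker H1 = rel_ker H2.
  apply/seteqP; split.
    (* H_j and H_j^+ share their kernel, so [op_le_kernel] for the inverses gives the reverse
       inclusion. *)
    rewrite -(mp_inverse_ker ip_norm sa1) -(mp_inverse_ker ip_norm sa2).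
    by apply: (op_le_kernel ip_norm sa2' sa1' le21 spN2' spN1'); rewrite dim21.
  by apply: (op_le_kernel ip_norm sa1 sa2 le12 spN1 spN2); rewrite dim12.
split=> //; rewrite /inertia ker12; congr InertiaIndex.
- by apply/le_anti; rewrite pos12.
- by apply/le_anti; rewrite dim12.
- by case: sa1 => _ ->; case: sa2 => _ ->.
Qed.
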